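(* Let $S=SO$ or $S=Sp$, and let $IU\subset U_{q,r}(s(N+2))$ be the subalgebra generated by $L^{-A}{}_B$, $L^{+a}{}_b$, $L^{+\circ}{}_\circ$, $L^{+\bullet}{}_\bullet$, $\varepsilon$. The Hopf algebra $IU$ is generated by the unit $\varepsilon$ and the entries of the matrices $$L^-=(L^{-A}{}_B),\qquad \mathcal L^+=\begin{pmatrix}L^{+\circ}{}_\circ&0&0\\0&L^{+a}{}_b&0\\0&0&L^{+\bullet}{}_\bullet\end{pmatrix};$$ these functionals satisfy the $q$-commutation relations $$R_{12}\mathcal L^+_2\mathcal L^+_1=\mathcal L^+_1\mathcal L^+_2R_{12},\ \text{ or equivalently }\ \mathcal R_{12}\mathcal L^+_2\mathcal L^+_1=\mathcal L^+_1\mathcal L^+_2\mathcal R_{12},$$ $$R_{12}L^-_2L^-_1=L^-_1L^-_2R_{12},\qquad \mathcal R_{12}\mathcal L^+_2L^-_1=L^-_1\mathcal L^+_2\mathcal R_{12},$$ where $\mathcal R_{12}=\mathcal L^+_2(T_1)$, that is $\mathcal R^{ab}{}_{cd}=R^{ab}{}_{cd}$, $\mathcal R^{AB}{}_{AB}=R^{AB}{}_{AB}$ (no sum) and $\mathcal R^{AB}{}_{CD}=0$ otherwise; and the orthogonality (symplecticity) conditions $$C^{AB}\mathcal L^{+C}{}_B\mathcal L^{+D}{}_A=C^{DC}\varepsilon,\quad C_{AB}\mathcal L^{+B}{}_C\mathcal L^{+A}{}_D=C_{DC}\varepsilon,\quad C^{AB}L^{-C}{}_BL^{-D}{}_A=C^{DC}\varepsilon,\quad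 C_{AB}L^{-B}{}_CL^{-A}{}_D=C_{DC}\varepsilon.$$ The co-structures are, for $\ell=\mathcal L^+$ or $\ell=L^-$: $\Delta'(\ell^A{}_B)=\ell^A{}_G\otimes\ell^G{}_B$, $\varepsilon'(\ell^A{}_B)=\delta^A_B$, $\kappa'(\ell^A{}_B)=C^{DA}\ell^C{}_DC_{BC}$.
   Context: Let $\epsilon=+1$ (orthogonal case, $S=SO$) or $\epsilon=-1$ (symplectic case, $S=Sp$, $N$ even), and $D=N+2$. Indices $A,B,\dots$ run over the ordered set $(\circ,1,\dots,N,\bullet)$, lower-case $a,b$ over $1,\dots,N$; $\circ'=\bullet$, $\bullet'=\circ$, $a'=N+1-a$; repeated indices are summed; for $D$ odd $n_2$ is the middle index. $r,q_{AB}$ are nonzero complex numbers with $q_{AA}=r$, $q_{BA}=r^2/q_{AB}$, $q_{AB}=r^2/q_{AB'}=r^2/q_{A'B}=q_{A'B'}$ (so $q_{AA'}=r$, and $q_{An_2}=r$ if $D$ is odd). In order, $(\rho_\circ,\rho_1,\dots,\rho_N,\rho_\bullet)$ equals $(\frac D2-1,\dots,\frac12,0,-\frac12,\dots,-\frac D2+1)$ for $\epsilon=1$, $D$ odd; $(\frac D2-1,\dots,1,0,0,-1,\dots,-\frac D2+1)$ for $\epsilon=1$, $D$ even; $(\frac D2,\dots,1,-1,\dots,-\frac D2)$ for $\epsilon=-1$. $\epsilon_A=1$ for $\epsilon=1$; for $\epsilon=-1$, $\epsilon_A=1$ for the first $D/2$ indices and $-1$ for the last $D/2$. The nonzero components of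 $R$ are (no sums): $R^{AA}{}_{AA}=r$ and $R^{AA'}{}_{AA'}=r^{-1}$ for $A\ne n_2$; $R^{n_2n_2}{}_{n_2n_2}=1$; $R^{AB}{}_{AB}=r/q_{AB}$ for $A\ne B$, $A'\ne B$; $R^{AB}{}_{BA}=r-r^{-1}$ for $A>B$, $A'\ne B$; $R^{AA'}{}_{A'A}=(r-r^{-1})(1-\epsilon r^{\rho_A-\rho_{A'}})$ for $A>A'$; $R^{AA'}{}_{BB'}=-(r-r^{-1})\epsilon_A\epsilon_Br^{\rho_A-\rho_B}$ for $A>B$, $A'\neq B$. The metric is $C_{AB}=\epsilon_Ar^{-\rho_A}\delta_{AB'}$ with inverse $C^{AB}$ ($C^{AB}C_{BC}=\delta^A_C$). $S_{q,r}(N+2)$ is the unital algebra generated by $T^A{}_B$ modulo $R^{AB}{}_{EF}T^E{}_CT^F{}_D=T^B{}_FT^A{}_ER^{EF}{}_{CD}$, $C^{BC}T^A{}_BT^D{}_C=C^{AD}I$, $C_{AC}T^A{}_BT^C{}_D=C_{BD}I$; it is a Hopf algebra with $\Delta(T^A{}_B)=T^A{}_C\otimes T^C{}_B$, $\varepsilon(T^A{}_B)=\delta^A_B$, $\kappa(T^A{}_B)=C^{AC}T^D{}_CC_{DB}$. $U_{q,r}(s(N+2))$ is the Hopf algebra of functionals on $S_{q,r}(N+2)$ (convolution product $\phi\psi=(\phi\otimes\psi)\Delta$, unit $\varepsilon$) generated by $\varepsilon$ and the functionals $L^{\pm A}{}_B$ defined by $L^{+A}{}_B(T^C{}_D)=R^{CA}{}_{DB}$,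 $L^{-A}{}_B(T^C{}_D)=(R^{-1})^{AC}{}_{BD}$, $L^{\pm A}{}_B(I)=\delta^A_B$, $L^{\pm A}{}_B(ab)=L^{\pm A}{}_C(a)L^{\pm C}{}_B(b)$. Matrix notation: $R_{12}X_2Y_1=Y_1X_2R_{12}$ means $R^{AB}{}_{EF}X^F{}_DY^E{}_C=Y^A{}_EX^B{}_FR^{EF}{}_{CD}$ (and the same with $\mathcal R$), products being convolution products. *)

(* Defs.v *)
From HB Require Import structures.
From mathcomp Require Import all_boot all_order all_algebra.
From mathcomp Require Import generic_quotient boolp reals complex.

Set Implicit Arguments.
Unset Strict Implicit.
Unset Printing Implicit Defensive.

Import Order.TTheory GRing.Theory Num.Theory.
Local Open Scope ring_scope.
Local Open Scope quotient_scope.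

(* The unital subalgebra generated by a set G. *)
Inductive subalg_gen (K : fieldType) (A : algType K) (G : A -> Prop) :
    A -> Prop :=
| subalg_in x of G x : subalg_gen G x
| subalg_1 : subalg_gen G 1
| subalg_D x y of subalg_gen G x & subalg_gen G y : subalg_gen G (x + y)
| subalg_Z k x of subalg_gen G x : subalg_gen G (k *: x)
| subalg_M x y of subalg_gen G x & subalg_gen G y : subalg_gen G (x * y).

Section OppositeAlgebra.
Variables (K : fieldType) (A : algType K).
HB.instance Definition _ := GRing.Lmodule.copy (A^c) A.
HB.instance Definition _ := GRing.Lmodule_isLalgebra.Build K A^c
  (fun k x y => @scalerAr K A k y x).
HB.instance Definition _ := GRing.Lalgebra_isAlgebra.Build K A^c
  (fun k x y => @scalerAl K A k y x).
End OppositeAlgebra.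

(* Algebras given by generators and relations: noncommutative polynomial
   expressions modulo the least algebra congruence containing the relations. *)

Inductive fterm (K : fieldType) (X : Type) : Type :=
| FConst of K
| FGen of X
| FAdd of fterm K X & fterm K X
| FMul of fterm K X & fterm K X.
Arguments FConst {K X}.
Arguments FGen {K X}.

HB.instance Definition _ (K : fieldType) (X : Type) := gen_eqMixin (fterm K X).
HB.instance Definition _ (K : fieldType) (X : Type) :=
  gen_choiceMixin (fterm K X).

Fixpoint peval (K : fieldType) (X : Type) (B : algType K) (f : X -> B)
    (a : fterm K X) : B :=
  match a with
  | FConst k => k *: 1
  | FGen x => f x
  | FAdd a b => peval f a + peval f b
  | FMul a b => peval f a * peval f b
  end.

(* A presentation together with a character of the presented algebra; the
   character is only there because algType excludes the zero ring. *)
Record presentation (K : fieldType) := Presentation {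
  pgens : Type;
  prels : fterm K pgens -> fterm K pgens -> Prop;
  pchr : pgens -> K^o;
  pchrP : forall a b, prels a b -> peval pchr a = peval pchr b
}.

Section Presented.
Variables (K : fieldType) (P : presentation K).
Local Notation X := (pgens P).
Local Notation term := (fterm K X).

Inductive cong : term -> term -> Prop :=
| cong_rel a b of prels a b : cong a b
| cong_refl a : cong a a
| cong_sym a b of cong a b : cong b a
| cong_trans a b c of cong a b & cong b c : cong a c
| cong_add a b c d of cong a b & cong c d : cong (FAdd a c) (FAdd b d)
| cong_mul a b c d of cong a b & cong c d : cong (FMul a c) (FMul b d)
| cong_addA a b c : cong (FAdd a (FAdd b c)) (FAdd (FAdd a b) c)
| cong_addC a b : cong (FAdd a b) (FAdd b a)
| cong_add0 a : cong (FAdd (FConst 0) a) a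
| cong_addN a : cong (FAdd (FMul (FConst (-1)) a) a) (FConst 0)
| cong_mulA a b c : cong (FMul a (FMul b c)) (FMul (FMul a b) c)
| cong_mul1l a : cong (FMul (FConst 1) a) a
| cong_mul1r a : cong (FMul a (FConst 1)) a
| cong_mulDl a b c : cong (FMul (FAdd a b) c) (FAdd (FMul a c) (FMul b c))
| cong_mulDr a b c : cong (FMul a (FAdd b c)) (FAdd (FMul a b) (FMul a c))
| cong_constD k l : cong (FConst (k + l)) (FAdd (FConst k) (FConst l))
| cong_constM k l : cong (FConst (k * l)) (FMul (FConst k) (FConst l))
| cong_constC k a : cong (FMul (FConst k) a) (FMul a (FConst k)).

Definition congb : rel term := fun a b => `[< cong a b >].

Fact congb_equiv : equiv_class_of congb.
Proof.
split=> [a|a b|b a c].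
- by apply/asboolP; apply: cong_refl.
- by apply/asboolP/asboolP => h; apply: cong_sym.
- by move=> /asboolP h1 /asboolP h2; apply/asboolP; apply: cong_trans h2.
Qed.
Canonical cong_equiv := EquivRelPack congb_equiv.

Definition presented := {eq_quot cong_equiv}.
HB.instance Definition _ := Choice.on presented.
HB.instance Definition _ := EqQuotient.on presented.

Definition pclass (a : term) : presented := \pi_presented a.
Definition pgen (x : X) : presented := pclass (FGen x).
Definition padd (x y : presented) := pclass (FAdd (repr x) (repr y)).
Definition pmul (x y : presented) := pclass (FMul (repr x) (repr y)).
Definition pconst (k : K) := pclass (FConst k).
Definition popp (x : presented) := pmul (pconst (-1)) x.
Definition pscale (k : K) (x : presented) := pmul (pconst k) x.

Lemma pclassP a b : pclass a = pclass b <-> cong a b.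
Proof.
split; first by move=> /eqmodP /asboolP.
by move=> h; apply/eqmodP/asboolP.
Qed.

Lemma pclassK x : pclass (repr x) = x.
Proof. exact: reprK. Qed.

Lemma cong_repr a : cong (repr (pclass a)) a.
Proof. by apply/pclassP; rewrite pclassK. Qed.

Lemma paddE a b : padd (pclass a) (pclass b) = pclass (FAdd a b).
Proof. by apply/pclassP/cong_add; apply: cong_repr. Qed.

Lemma pmulE a b : pmul (pclass a) (pclass b) = pclass (FMul a b).
Proof. by apply/pclassP/cong_mul; apply: cong_repr. Qed.

Lemma pclass_ind (Q : presented -> Prop) :
  (forall a, Q (pclass a)) -> forall x, Q x.
Proof. by move=> h x; rewrite -(pclassK x). Qed.

Fact paddA : associative padd.
Proof.
elim/pclass_ind=> a; elim/pclass_ind=> b; elim/pclass_ind=> c.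
by rewrite !paddE; apply/pclassP/cong_addA.
Qed.
Fact paddC : commutative padd.
Proof.
elim/pclass_ind=> a; elim/pclass_ind=> b.
by rewrite !paddE; apply/pclassP/cong_addC.
Qed.
Fact padd0 : left_id (pconst 0) padd.
Proof. by elim/pclass_ind=> a; rewrite paddE; apply/pclassP/cong_add0. Qed.
Fact paddN : left_inverse (pconst 0) popp padd.
Proof.
by elim/pclass_ind=> a; rewrite /popp pmulE paddE; apply/pclassP/cong_addN.
Qed.
HB.instance Definition _ :=
  GRing.isZmodule.Build presented paddA paddC padd0 paddN.

Fact pmulA : associative pmul.
Proof.
elim/pclass_ind=> a; elim/pclass_ind=> b; elim/pclass_ind=> c.
by rewrite !pmulE; apply/pclassP/cong_mulA.
Qed.
Fact pmul1l : left_id (pconst 1) pmul.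
Proof. by elim/pclass_ind=> a; rewrite pmulE; apply/pclassP/cong_mul1l. Qed.
Fact pmul1r : right_id (pconst 1) pmul.
Proof. by elim/pclass_ind=> a; rewrite pmulE; apply/pclassP/cong_mul1r. Qed.
Fact pmulDl : left_distributive pmul padd.
Proof.
elim/pclass_ind=> a; elim/pclass_ind=> b; elim/pclass_ind=> c.
by rewrite !(paddE, pmulE); apply/pclassP/cong_mulDl.
Qed.
Fact pmulDr : right_distributive pmul padd.
Proof.
elim/pclass_ind=> a; elim/pclass_ind=> b; elim/pclass_ind=> c.
by rewrite !(paddE, pmulE); apply/pclassP/cong_mulDr.
Qed.
HB.instance Definition _ := GRing.Zmodule_isPzRing.Build presented
  pmulA pmul1l pmul1r pmulDl pmulDr.

Fact pconstD k l : pconst (k + l) = pconst k + pconst l.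
Proof. by rewrite [RHS]paddE; apply/pclassP/cong_constD. Qed.
Fact pconstM k l : pconst (k * l) = pconst k * pconst l.
Proof. by rewrite [RHS]pmulE; apply/pclassP/cong_constM. Qed.
Fact pconstC k (x : presented) : pconst k * x = x * pconst k.
Proof.
elim/pclass_ind: x => a; rewrite [LHS]pmulE [RHS]pmulE.
by apply/pclassP/cong_constC.
Qed.

Fact pscaleA k l x : pscale k (pscale l x) = pscale (k * l) x.
Proof. by rewrite /pscale pconstM -pmulA. Qed.
Fact pscale1 : left_id 1 pscale.
Proof. exact: pmul1l. Qed.
Fact pscaleDr : right_distributive pscale +%R.
Proof. by move=> k x y; apply: pmulDr. Qed.
Fact pscaleDl x : {morph pscale^~ x : k l / k + l}.
Proof. by move=> k l; rewrite /pscale pconstD; apply: pmulDl. Qed.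
HB.instance Definition _ := GRing.Zmodule_isLmodule.Build K presented
  pscaleA pscale1 pscaleDr pscaleDl.

Section EvalCong.
Variables (B : algType K) (f : X -> B).
Hypothesis Hf : forall a b, prels a b -> peval f a = peval f b.

Lemma peval_cong a b : cong a b -> peval f a = peval f b.
Proof.
elim=> {a b} //=.
- by move=> a b c _ -> _ ->.
- by move=> a b c d _ -> _ ->.
- by move=> a b c d _ -> _ ->.
- by move=> *; rewrite addrA.
- by move=> *; rewrite addrC.
- by move=> *; rewrite scale0r add0r.
- by move=> a; rewrite -scalerAl mul1r scaleN1r addNr scale0r.
- by move=> *; rewrite mulrA.
- by move=> *; rewrite scale1r mul1r.
- by move=> *; rewrite scale1r mulr1.
- by move=> *; rewrite mulrDl.
- by move=> *; rewrite mulrDr.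
- by move=> *; rewrite scalerDl.
- by move=> *; rewrite -scalerAl mul1r scalerA.
- by move=> *; rewrite -scalerAl -scalerAr mul1r mulr1.
Qed.

End EvalCong.

Fact presented_nonzero : (1 : presented) != 0.
Proof.
apply/eqP => /pclassP /(peval_cong (@pchrP K P)) /= /eqP.
by rewrite scale1r scale0r oner_eq0.
Qed.
HB.instance Definition _ := GRing.PzSemiRing_isNonZero.Build presented
  presented_nonzero.

Fact presented_scalerAl k (x y : presented) : k *: (x * y) = (k *: x) * y.
Proof. exact: pmulA. Qed.
Fact presented_scalerAr k (x y : presented) : k *: (x * y) = x * (k *: y).
Proof.
by rewrite presented_scalerAl -[k *: x]/(pconst k * x) pconstC -mulrA.
Qed.
HB.instance Definition _ :=
  GRing.Lmodule_isLalgebra.Build K presented presented_scalerAl.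
HB.instance Definition _ :=
  GRing.Lalgebra_isAlgebra.Build K presented presented_scalerAr.

Lemma pclassD a b : pclass (FAdd a b) = pclass a + pclass b.
Proof. by rewrite -paddE. Qed.
Lemma pclassM a b : pclass (FMul a b) = pclass a * pclass b.
Proof. by rewrite -pmulE. Qed.
Lemma pclassC k : pclass (FConst k) = k *: 1.
Proof. by rewrite -[RHS]/(pconst k * 1) mulr1. Qed.

Section Lift.
Variables (B : algType K) (f : X -> B).
Hypothesis Hf : forall a b, prels a b -> peval f a = peval f b.

(* The algebra map sending the generator x to f x. *)
Definition plift of (forall a b, prels a b -> peval f a = peval f b) :
  presented -> B := fun x => peval f (repr x).

Lemma plift_class a : plift Hf (pclass a) = peval f a.
Proof. exact/(peval_cong Hf)/cong_repr. Qed.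

Lemma plift_gen x : plift Hf (pgen x) = f x.
Proof. exact: plift_class. Qed.

Fact plift_linear : linear (plift Hf).
Proof.
move=> k; elim/pclass_ind=> a; elim/pclass_ind=> b.
rewrite -[k *: _]/(pconst k * _) -pclassM -pclassD !plift_class /=.
by rewrite -scalerAl mul1r.
Qed.
HB.instance Definition _ :=
  GRing.isLinear.Build K presented B *:%R (plift Hf) plift_linear.

Fact plift_multiplicative : monoid_morphism (plift Hf).
Proof.
split; first by rewrite -[1]/(pconst 1) plift_class /= scale1r.
elim/pclass_ind=> a; elim/pclass_ind=> b.
by rewrite -pclassM !plift_class.
Qed.
HB.instance Definition _ :=
  GRing.isMonoidMorphism.Build presented B (plift Hf) plift_multiplicative.
End Lift.
End Presented.

(* Functionals, i.e. the linear dual of a K-module. *)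

Definition functional (K : fieldType) (A : lmodType K) := {linear A -> K^o}.

HB.instance Definition _ (K : fieldType) (A : lmodType K) :=
  gen_eqMixin (functional A).
HB.instance Definition _ (K : fieldType) (A : lmodType K) :=
  gen_choiceMixin (functional A).

Section Functional.
Variables (K : fieldType) (A : lmodType K).
Implicit Types phi psi : functional A.

Lemma functionalP phi psi : (forall x, phi x = psi x) -> phi = psi.
Proof.
case: phi psi => [f [[a1] [b1]]] [g [[a2] [b2]]] /= /funext efg.
case: _ / efg in a2 b2 *.
by congr GRing.Linear.Pack; congr GRing.Linear.Class; congr (_ _);
  apply: Prop_irrelevance.
Qed.

Definition fadd_fun phi psi : A -> K^o := fun x => phi x + psi x.
Fact fadd_linear phi psi : linear (fadd_fun phi psi).
Proof. by move=> k x y; rewrite /fadd_fun !linearP scalerDr addrACA. Qed.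
HB.instance Definition _ phi psi :=
  GRing.isLinear.Build K A K^o *:%R (fadd_fun phi psi) (fadd_linear phi psi).
Definition fadd phi psi : functional A := fadd_fun phi psi.

Definition fscale_fun (c : K) phi : A -> K^o := fun x => c * phi x.
Fact fscale_linear c phi : linear (fscale_fun c phi).
Proof.
move=> k x y; rewrite /fscale_fun linearP mulrDr; congr (_ + _).
exact: mulrCA.
Qed.
HB.instance Definition _ c phi :=
  GRing.isLinear.Build K A K^o *:%R (fscale_fun c phi) (fscale_linear c phi).
Definition fscale (c : K) phi : functional A := fscale_fun c phi.

Definition fzero_fun : A -> K^o := fun=> 0.
Fact fzero_linear : linear fzero_fun.
Proof. by move=> k x y; rewrite /fzero_fun scaler0 addr0. Qed.
HB.instance Definition _ :=
  GRing.isLinear.Build K A K^o *:%R fzero_fun fzero_linear.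
Definition fzero : functional A := fzero_fun.

Fact faddA : associative fadd.
Proof. by move=> f g h; apply: functionalP => x; apply: addrA. Qed.
Fact faddC : commutative fadd.
Proof. by move=> f g; apply: functionalP => x; apply: addrC. Qed.
Fact fadd0 : left_id fzero fadd.
Proof. by move=> f; apply: functionalP => x; apply: add0r. Qed.
Fact faddN : left_inverse fzero (fscale (-1)) fadd.
Proof.
move=> f; apply: functionalP => x.
by rewrite /= /fadd_fun /= /fscale_fun mulN1r addNr.
Qed.
HB.instance Definition _ :=
  GRing.isZmodule.Build (functional A) faddA faddC fadd0 faddN.

Fact fscaleA a b phi : fscale a (fscale b phi) = fscale (a * b) phi.
Proof. by apply: functionalP => x; apply: mulrA. Qed.
Fact fscale1 : left_id 1 fscale.
Proof. by move=> f; apply: functionalP => x; apply: mul1r. Qed.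
Fact fscaleDr : right_distributive fscale +%R.
Proof. by move=> c f g; apply: functionalP => x; apply: mulrDr. Qed.
Fact fscaleDl phi : {morph fscale^~ phi : a b / a + b}.
Proof. by move=> a b; apply: functionalP => x; apply: mulrDl. Qed.
HB.instance Definition _ := GRing.Zmodule_isLmodule.Build K (functional A)
  fscaleA fscale1 fscaleDr fscaleDl.

Lemma functional_add phi psi x : (phi + psi) x = phi x + psi x.
Proof. by []. Qed.
Lemma functional_scale (c : K) phi x : (c *: phi) x = c * phi x.
Proof. by []. Qed.
Lemma functional_zero x : (0 : functional A) x = 0.
Proof. by []. Qed.
Lemma functional_sum (I : Type) (r : seq I) (Q : pred I)
    (phi : I -> functional A) x :
  (\sum_(i <- r | Q i) phi i) x = \sum_(i <- r | Q i) phi i x.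
Proof. by elim/big_rec2: _ => // i y f _ <-. Qed.
End Functional.

Definition bilin (K : fieldType) (A B V : lmodType K) (beta : A -> B -> V) :=
  (forall b, linear (beta^~ b)) /\ (forall a, linear (beta a)).

(* The tensor product algebra A (x) B, presented as the algebra generated by
   two commuting copies of A and B; chi and psi are characters of A and B. *)
Section Tensor.
Variables (K : fieldType) (A B : algType K).
Variables (chi : {lrmorphism A -> K^o}) (psi : {lrmorphism B -> K^o}).

Local Notation gl a := (FGen (inl a)).
Local Notation gr b := (FGen (inr b)).

Inductive tens_rel : fterm K (A + B) -> fterm K (A + B) -> Prop :=
| tens_l1 : tens_rel (gl 1) (FConst 1)
| tens_lD a a' : tens_rel (gl (a + a')) (FAdd (gl a) (gl a'))
| tens_lZ k a : tens_rel (gl (k *: a)) (FMul (FConst k) (gl a))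
| tens_lM a a' : tens_rel (gl (a * a')) (FMul (gl a) (gl a'))
| tens_r1 : tens_rel (gr 1) (FConst 1)
| tens_rD b b' : tens_rel (gr (b + b')) (FAdd (gr b) (gr b'))
| tens_rZ k b : tens_rel (gr (k *: b)) (FMul (FConst k) (gr b))
| tens_rM b b' : tens_rel (gr (b * b')) (FMul (gr b) (gr b'))
| tens_comm a b : tens_rel (FMul (gl a) (gr b)) (FMul (gr b) (gl a)).

Definition tens_chr (x : A + B) : K^o :=
  match x with inl a => chi a | inr b => psi b end.

Fact tens_chrP s t : tens_rel s t -> peval tens_chr s = peval tens_chr t.
Proof.
case=> {s t} /= [|a a'|k a|a a'||b b'|k b|b b'|a b].
- by rewrite scale1r rmorph1.
- by rewrite raddfD.
- by rewrite linearZ -scalerAl mul1r.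
- by rewrite rmorphM.
- by rewrite scale1r rmorph1.
- by rewrite raddfD.
- by rewrite linearZ -scalerAl mul1r.
- by rewrite rmorphM.
- by rewrite mulrC.
Qed.

Definition tens_pres := Presentation tens_chrP.
Definition tensor := presented tens_pres.

Definition tpure (a : A) (b : B) : tensor :=
  @pclass K tens_pres (FMul (gl a) (gr b)).

Section TensorLift.
Variable V : lmodType K.
Implicit Type beta : A -> B -> V.

(* (tens_act t beta) x y is the value of beta at (x (x) y) * t. *)
Fixpoint tens_act (t : fterm K (A + B)) beta : A -> B -> V :=
  match t with
  | FConst k => fun x y => k *: beta x y
  | FGen (inl a) => fun x y => beta (x * a) y
  | FGen (inr b) => fun x y => beta x (y * b)
  | FAdd t u => fun x y => tens_act t beta x y + tens_act u beta x y
  | FMul t u => tens_act t (tens_act u beta)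
  end.

Lemma tens_act_bilin t beta : bilin beta -> bilin (tens_act t beta).
Proof.
elim: t beta => [k|[a|b]|t IHt u IHu|t IHt u IHu] beta hb /=; last first.
- exact/IHt/IHu.
- have [ht1 ht2] := IHt _ hb; have [hu1 hu2] := IHu _ hb.
  by split=> z k x y; rewrite ?(ht1, hu1) ?(ht2, hu2) scalerDr addrACA.
- have [h1 h2] := hb.
  by split=> z k x y; rewrite ?h1 // mulrDl -scalerAl h2.
- have [h1 h2] := hb.
  by split=> z k x y; rewrite ?h2 // mulrDl -scalerAl h1.
- have [h1 h2] := hb.
  split=> z c x y; rewrite ?(h1, h2) scalerDr !scalerA; congr (_ + _);
  by rewrite mulrC.
Qed.

Lemma tens_act_lin t k beta gamma x y :
  tens_act t (fun a b => k *: beta a b + gamma a b) x y =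
  k *: tens_act t beta x y + tens_act t gamma x y.
Proof.
elim: t beta gamma k x y => [c|[a|b]|t IHt u IHu|t IHt u IHu]
    beta gamma k x y //=.
- by rewrite scalerDr !scalerA mulrC.
- by rewrite IHt IHu scalerDr addrACA.
- have -> : tens_act u (fun a b => k *: beta a b + gamma a b) =
      fun a b => k *: tens_act u beta a b + tens_act u gamma a b.
    by apply/funext => a; apply/funext => b; apply: IHu.
  exact: IHt.
Qed.

Lemma tens_act_const t k beta x y :
  tens_act t (fun a b => k *: beta a b) x y = k *: tens_act t beta x y.
Proof.
have := tens_act_lin t k beta (fun _ _ => 0) x y.
have h0 : tens_act t (fun _ _ => 0) x y = 0.
  have := tens_act_lin t (-1) (fun _ _ => 0) (fun _ _ => 0) x y.
  by under eq_fun do under eq_fun do rewrite scaler0 addr0;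
    rewrite scaleN1r addNr.
by under eq_fun do under eq_fun do rewrite addr0; rewrite h0 addr0.
Qed.

Lemma tens_act_cong t u : @cong K tens_pres t u ->
  forall beta, bilin beta -> tens_act t beta = tens_act u beta.
Proof.
elim=> {t u} /=.
- move=> t u rtu beta [h1 h2]; apply/funext => x; apply/funext => y.
  have D1 a a' b : beta (a + a') b = beta a b + beta a' b.
    by have := h1 b 1 a a'; rewrite !scale1r.
  have D2 a b b' : beta a (b + b') = beta a b + beta a b'.
    by have := h2 a 1 b b'; rewrite !scale1r.
  have Z1 k a b : beta (k *: a) b = k *: beta a b.
    have := h1 b k a 0; rewrite addr0 => ->.
    have -> : beta 0 b = 0 by apply: (addIr (beta 0 b)); rewrite -D1 addr0 add0r.
    by rewrite addr0.
  have Z2 k a b : beta a (k *: b) = k *: beta a b.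
    have := h2 a k b 0; rewrite addr0 => ->.
    have -> : beta a 0 = 0 by apply: (addIr (beta a 0)); rewrite -D2 addr0 add0r.
    by rewrite addr0.
  by case: rtu => * /=;
    rewrite ?(mulr1, scale1r, mulrDr, mulrA, D1, D2) -?scalerAr ?(Z1, Z2).
- by [].
- by move=> a b _ h beta hb; rewrite h.
- by move=> a b c _ h _ h' beta hb; rewrite h // h'.
- by move=> a b c d _ h _ h' beta hb; rewrite h // h'.
- move=> a b c d _ h _ h' beta hb; rewrite h' // h //.
  exact: tens_act_bilin.
- by move=> a b c beta hb; apply/funext => x; apply/funext => y; rewrite addrA.
- by move=> a b beta hb; apply/funext => x; apply/funext => y; rewrite addrC.
- move=> a beta hb; apply/funext => x; apply/funext => y.
  by rewrite scale0r add0r.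
- move=> a beta hb; apply/funext => x; apply/funext => y.
  by rewrite scaleN1r addNr scale0r.
- by [].
- by move=> a beta hb; apply/funext => x; apply/funext => y; rewrite scale1r.
- move=> a beta hb; congr (tens_act a _).
  by apply/funext => x; apply/funext => y; rewrite scale1r.
- by [].
- move=> a b c beta hb; apply/funext => x; apply/funext => y.
  have := tens_act_lin a 1 (tens_act b beta) (tens_act c beta) x y.
  by rewrite scale1r => <-; congr tens_act; apply/funext => u; apply/funext => v;
    rewrite scale1r.
- move=> k l beta hb; apply/funext => x; apply/funext => y.
  exact: scalerDl.
- move=> k l beta hb; apply/funext => x; apply/funext => y.
  by rewrite scalerA.
- move=> k a beta hb; apply/funext => x; apply/funext => y.
  by rewrite tens_act_const.
Qed.

(* The linear map on A (x) B induced by a bilinear map. *)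
Definition tlift beta of bilin beta : tensor -> V :=
  fun t => tens_act (repr t) beta 1 1.

Lemma tlift_class beta (hb : bilin beta) (t : fterm K (A + B)) :
  tlift hb (@pclass K tens_pres t) = tens_act t beta 1 1.
Proof.
by rewrite /tlift (@tens_act_cong (repr (@pclass K tens_pres t)) t) //;
  apply: cong_repr.
Qed.

Fact tlift_linear beta (hb : bilin beta) : linear (tlift hb).
Proof.
move=> k; elim/pclass_ind=> s; elim/pclass_ind=> t.
rewrite -[k *: _]/(pconst tens_pres k * _) -pclassM -pclassD.
by rewrite !tlift_class.
Qed.
HB.instance Definition _ beta (hb : bilin beta) :=
  GRing.isLinear.Build K tensor V *:%R (tlift hb) (tlift_linear hb).

Lemma tlift_pure beta (hb : bilin beta) a b : tlift hb (tpure a b) = beta a b.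
Proof. by rewrite tlift_class /= !mul1r. Qed.

Fact bilin_mulr beta (hb : bilin beta) a b :
  bilin (fun x y => beta (x * a) (y * b)).
Proof.
have [h1 h2] := hb.
by split=> z k x y; rewrite mulrDl -scalerAl ?(h1, h2).
Qed.

Lemma tlift_mulr beta (hb : bilin beta) t a b :
  tlift hb (t * tpure a b) = tlift (bilin_mulr hb a b) t.
Proof.
elim/pclass_ind: t => t.
by rewrite /tpure -pclassM !tlift_class.
Qed.
End TensorLift.

Local Notation tl a := (@pclass K tens_pres (gl a)).
Local Notation tr b := (@pclass K tens_pres (gr b)).

Lemma tens_relP s t : tens_rel s t ->
  @pclass K tens_pres s = @pclass K tens_pres t.
Proof. by move=> h; apply/pclassP; apply: cong_rel. Qed.

Lemma tpureE a b : tpure a b = tl a * tr b.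
Proof. exact: pclassM. Qed.

Lemma tpureM a a' b b' : tpure a b * tpure a' b' = tpure (a * a') (b * b').
Proof.
rewrite !tpureE (tens_relP (tens_lM _ _)) (tens_relP (tens_rM _ _)) !pclassM.
rewrite -!mulrA; congr (_ * _); rewrite !mulrA; congr (_ * _).
by rewrite -!pclassM (tens_relP (tens_comm _ _)).
Qed.

Lemma tpure1 : tpure 1 1 = 1.
Proof.
rewrite tpureE (tens_relP tens_l1) (tens_relP tens_r1) !pclassC !scale1r.
exact: mulr1.
Qed.

Fact tpure_bilin : bilin tpure.
Proof.
split=> [b|a] k x y; rewrite !tpureE.
  rewrite (tens_relP (tens_lD _ _)) pclassD (tens_relP (tens_lZ _ _)) pclassM.
  by rewrite pclassC -scalerAl mul1r mulrDl -scalerAl.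
rewrite (tens_relP (tens_rD _ _)) pclassD (tens_relP (tens_rZ _ _)) pclassM.
by rewrite pclassC -scalerAl mul1r mulrDr -scalerAr.
Qed.

Fact tensf_bilin (f : functional A) (g : functional B) :
  bilin (fun a b => f a * g b : K^o).
Proof.
split=> z k x y; rewrite linearP ?mulrDl ?mulrDr; congr (_ + _).
  exact: esym (mulrA _ _ _).
exact: mulrCA.
Qed.

(* f (x) g as a functional on A (x) B *)
Definition tensf (f : functional A) (g : functional B) : functional tensor :=
  tlift (tensf_bilin f g).
End Tensor.

Inductive series := SO | Sp.

(* The indices (circ, 1, ..., N, bullet) are the elements 0, 1, ..., N, N+1 of
   'I_N.+2, so that A' is rev_ord A. *)
Local Notation idx N := 'I_N.+2.

(* The index n_2, which exists for N odd only. *)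
Definition middle N (A : idx N) : bool := rev_ord A == A.

(* 2 rho_A; rho_A itself need not be an integer for S = SO and N odd. *)
Definition rho2 (S : series) N (A : idx N) : int :=
  let h (B : idx N) : int := (if S is SO then N - B.*2 else N.+2 - B.*2)%N in
  if (A < rev_ord A)%N then h A
  else if (rev_ord A < A)%N then - h (rev_ord A) else 0.

Record qparams (K : fieldType) (S : series) (N : nat) := QParams {
  qr : K;
  (* a square root of r, fixing the meaning of r ^ rho for half-integers rho *)
  qrt : K;
  qq : idx N -> idx N -> K;
  qrt_sq : qrt ^+ 2 = qr;
  qr_neq0 : qr != 0;
  qq_neq0 : forall A B, qq A B != 0;
  sp_even : S = Sp -> ~~ odd N;
  qq_diag : forall A, qq A A = qr;
  qq_swap : forall A B, qq B A = qr ^+ 2 / qq A B;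
  qq_primer : forall A B, qq A B = qr ^+ 2 / qq A (rev_ord B);
  qq_primel : forall A B, qq A B = qr ^+ 2 / qq (rev_ord A) B;
  qq_primelr : forall A B, qq A B = qq (rev_ord A) (rev_ord B);
  qq_middle : forall A B, middle B -> qq A B = qr
}.

Section QuantumGroup.
Variables (K : fieldType) (S : series) (N : nat) (p : qparams K S N).
Local Notation I := (idx N).
Local Notation r := (qr p).
Local Notation q := (qq p).

(* r ^ (z / 2) *)
Definition rpow2 (z : int) : K := qrt p ^ z.

Definition eps : K := if S is SO then 1 else -1.

Definition epsi (A : I) : K :=
  if S is SO then 1 else if (A < (N.+2)./2)%N then 1 else -1.

(* R A B C D is the component R^{AB}_{CD}. *)
Definition Rmat (A B C D : I) : K :=
  if [&& B == A, C == A & D == A] then (if middle A then 1 else r)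
  else if [&& B == rev_ord A, C == A & D == B] then r^-1
  else if (C == A) && (D == B) then r / q A B
  else if [&& C == B, D == A & B != rev_ord A] then
    (if (B < A)%N then r - r^-1 else 0)
  else if [&& C == B, D == A & B == rev_ord A] then
    (if (B < A)%N then
       (r - r^-1) * (1 - eps * rpow2 (rho2 S A - rho2 S (rev_ord A))) else 0)
  else if (B == rev_ord A) && (D == rev_ord C) then
    (if (C < A)%N then
       - (r - r^-1) * epsi A * epsi C * rpow2 (rho2 S A - rho2 S C) else 0)
  else 0.

(* The components (R^{-1})^{AB}_{CD} of the inverse of R, viewed as a square
   matrix whose rows (columns) are indexed by the pairs AB (CD). *)
Definition Rsquare : 'M[K]_#|{: I * I}| :=
  \matrix_(i, j) Rmat (enum_val i).1 (enum_val i).2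
                      (enum_val j).1 (enum_val j).2.
Definition Rinv (A B C D : I) : K :=
  invmx Rsquare (enum_rank (A, B)) (enum_rank (C, D)).

(* The metric C_{AB} and its inverse C^{AB}. *)
Definition Clo_mx : 'M[K]_N.+2 :=
  \matrix_(A, B) (epsi A * rpow2 (- rho2 S A) *+ (A == rev_ord B)).
Definition Clo (A B : I) : K := Clo_mx A B.
Definition Cup (A B : I) : K := invmx Clo_mx A B.

Lemma Cmx_unit : Clo_mx \in unitmx.
Proof.
have t0 : qrt p != 0.
  by have := qr_neq0 p; rewrite -qrt_sq sqrf_eq0.
pose c (A : I) := epsi A * rpow2 (- rho2 S A).
have c0 A : c A != 0.
  rewrite mulf_neq0 ?expfz_neq0 // /epsi; case: S; rewrite ?oner_eq0 //.
  by case: ifP; rewrite ?oppr_eq0 oner_eq0.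
pose D : 'M[K]_N.+2 := \matrix_(A, B) ((c B)^-1 *+ (A == rev_ord B)).
suff /mulmx1_unit[] : Clo_mx *m D = 1%:M by [].
apply/matrixP => A B; rewrite !mxE (bigD1 (rev_ord A)) //= big1 ?addr0.
  rewrite !mxE rev_ordK eqxx (inj_eq rev_ord_inj) -/(c A) mulr1n.
  by case: eqP => [->|_]; rewrite ?mulr0n ?mulr0 // mulr1n divff.
move=> C hC; rewrite !mxE; case: eqP => [h|_]; last by rewrite mulr0n mul0r.
by rewrite h rev_ordK eqxx in hC.
Qed.

Lemma Cup_Clo A B : \sum_C Cup A C * Clo C B = (A == B)%:R.
Proof.
by have /matrixP/(_ A B) := mulVmx Cmx_unit; rewrite !mxE.
Qed.

Lemma Clo_Cup A B : \sum_C Clo A C * Cup C B = (A == B)%:R.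
Proof.
by have /matrixP/(_ A B) := mulmxV Cmx_unit; rewrite !mxE.
Qed.

Local Notation term := (fterm K (I * I)).
Local Notation T_ A B := (FGen (A, B) : term).
Local Notation "k *** t" := (FMul (FConst k) t) (at level 40).
Local Notation "t ** u" := (FMul t u) (at level 39).
Local Notation "\fsum_ A F" := (\big[@FAdd K (I * I)/FConst 0]_(A : I) F)
  (at level 41, A name, F at level 41).

Inductive qrel : term -> term -> Prop :=
| qrel_RTT A B C D : qrel
    (\fsum_E \fsum_F (Rmat A B E F *** (T_ E C ** T_ F D)))
    (\fsum_E \fsum_F (Rmat E F C D *** (T_ B F ** T_ A E)))
| qrel_Cup A D : qrel
    (\fsum_B \fsum_C (Cup B C *** (T_ A B ** T_ D C))) (FConst (Cup A D))
| qrel_Clo B D : qrel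
    (\fsum_A \fsum_C (Clo A C *** (T_ A B ** T_ C D))) (FConst (Clo B D)).

Lemma peval_fsum (B : algType K) (f : I * I -> B) (t : I -> term) :
  peval f (\fsum_A t A) = \sum_A peval f (t A).
Proof. by apply: big_morph => //=; rewrite scale0r. Qed.

Lemma peval_fsum2 (B : algType K) (f : I * I -> B) (k : I -> I -> K)
    (t u : I -> I -> term) :
  peval f (\fsum_C \fsum_D (k C D *** (t C D ** u C D))) =
  \sum_C \sum_D k C D *: (peval f (t C D) * peval f (u C D)).
Proof.
rewrite peval_fsum; apply: eq_bigr => C _; rewrite peval_fsum.
by apply: eq_bigr => D _ /=; rewrite -scalerAl mul1r.
Qed.

Lemma qrel_respect (B : algType K) (f : I -> I -> B) :
  (forall A B C D,
    \sum_E \sum_F Rmat A B E F *: (f E C * f F D) =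
    \sum_E \sum_F Rmat E F C D *: (f B F * f A E)) ->
  (forall A D, \sum_B \sum_C Cup B C *: (f A B * f D C) = Cup A D *: 1) ->
  (forall B D, \sum_A \sum_C Clo A C *: (f A B * f C D) = Clo B D *: 1) ->
  forall s t, qrel s t ->
  peval (fun x => f x.1 x.2) s = peval (fun x => f x.1 x.2) t.
Proof.
move=> h1 h2 h3 s t; case=> {s t} *; rewrite !peval_fsum2 /=.
- exact: h1.
- exact: h2.
- exact: h3.
Qed.

Lemma sum_delta (V : lmodType K) (F : I -> V) A :
  \sum_B (B == A)%:R *: F B = F A.
Proof.
rewrite (bigD1 A) //= eqxx scale1r big1 ?addr0 // => B /negPf ->.
exact: scale0r.
Qed.

Lemma sum_delta' (V : lmodType K) (F : I -> V) A :
  \sum_B (A == B)%:R *: F B = F A.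
Proof. by rewrite -[RHS]sum_delta; apply: eq_bigr => B _; rewrite eq_sym. Qed.

(* The character T^A_B |-> delta^A_B, which is the counit. *)
Definition delta_chr (A B : I) : K^o := (A == B)%:R.

Fact qgroup_chrP s t : qrel s t ->
  peval (fun x => delta_chr x.1 x.2) s = peval (fun x => delta_chr x.1 x.2) t.
Proof.
have E2 (k : I -> I -> K) (A B : I) :
    \sum_E \sum_F k E F *: (delta_chr E A * delta_chr F B) = k A B :> K^o.
  under eq_bigr => E _.
    under eq_bigr => F _.
      have -> : k E F *: (delta_chr E A * delta_chr F B) =
        (F == B)%:R *: (k E F *: (E == A)%:R : K^o).
        by rewrite /delta_chr [LHS]mulrA [RHS]mulrC.
      over.
    rewrite sum_delta.
    have -> : k E B *: (E == A)%:R = (E == A)%:R *: (k E B : K^o) by exact: mulrC.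
    over.
  exact: sum_delta.
apply: qrel_respect => [A B C D|A D|B D].
- rewrite E2.
  under [RHS]eq_bigr => E _ do under eq_bigr => F _ do
    rewrite /delta_chr mulrC (eq_sym A) (eq_sym B).
  by rewrite E2.
- under eq_bigr => E _ do under eq_bigr => F _ do
    rewrite /delta_chr (eq_sym A) (eq_sym D).
  by rewrite E2; exact: esym (mulr1 _).
- by rewrite E2; exact: esym (mulr1 _).
Qed.

Definition qgroup_pres := Presentation qgroup_chrP.
(* S_{q,r}(N+2) *)
Definition qgroup := presented qgroup_pres.

Definition T (A B : I) : qgroup := @pgen K qgroup_pres (A, B).

Lemma pclass_fsum2 (k : I -> I -> K) (t u : I -> I -> term) :
  @pclass K qgroup_pres (\fsum_C \fsum_D (k C D *** (t C D ** u C D))) =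
  \sum_C \sum_D k C D *:
    (@pclass K qgroup_pres (t C D) * @pclass K qgroup_pres (u C D)).
Proof.
have h0 (t' : I -> term) : @pclass K qgroup_pres (\fsum_A t' A) =
    \sum_A @pclass K qgroup_pres (t' A).
  apply: big_morph => [x y|]; first exact: pclassD.
  by rewrite pclassC scale0r.
rewrite h0; apply: eq_bigr => C _; rewrite h0.
apply: eq_bigr => D _; rewrite (@pclassM K qgroup_pres).
by rewrite (@pclassM K qgroup_pres) pclassC -scalerAl mul1r.
Qed.

Lemma RTT A B C D :
  \sum_E \sum_F Rmat A B E F *: (T E C * T F D) =
  \sum_E \sum_F Rmat E F C D *: (T B F * T A E).
Proof.
have /(@cong_rel K qgroup_pres)/pclassP := qrel_RTT A B C D.
by rewrite !pclass_fsum2.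
Qed.

Lemma CTT_up A D : \sum_B \sum_C Cup B C *: (T A B * T D C) = Cup A D *: 1.
Proof.
have /(@cong_rel K qgroup_pres)/pclassP := qrel_Cup A D.
by rewrite !pclass_fsum2 pclassC.
Qed.

Lemma CTT_lo B D : \sum_A \sum_C Clo A C *: (T A B * T C D) = Clo B D *: 1.
Proof.
have /(@cong_rel K qgroup_pres)/pclassP := qrel_Clo B D.
by rewrite !pclass_fsum2 pclassC.
Qed.

Lemma qgroup_ind (Q : qgroup -> Prop) :
  Q 1 -> (forall k x y, Q x -> Q y -> Q (k *: x + y)) ->
  (forall x A B, Q x -> Q (x * T A B)) -> forall x, Q x.
Proof.
move=> Q1 QD QM.
have Q0 : Q 0 by have := QD (-1) 1 1 Q1 Q1; rewrite scaleN1r addNr.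
suff h t x : Q x -> Q (x * @pclass K qgroup_pres t).
  by elim/(@pclass_ind K qgroup_pres) => t; rewrite -[pclass _]mul1r; apply: h.
elim: t x => [k|[A B]|a IHa b IHb|a IHa b IHb] x Qx.
- rewrite (@pclassC K qgroup_pres) -scalerAr mulr1 -[k *: x]addr0.
  exact: QD.
- exact: QM.
- rewrite (@pclassD K qgroup_pres) mulrDr -[x * _]scale1r.
  by apply: QD; [apply: IHa|apply: IHb].
- by rewrite (@pclassM K qgroup_pres) mulrA; apply/IHb/IHa.
Qed.

Definition counit : qgroup -> K^o :=
  @plift K qgroup_pres K^o _ qgroup_chrP.
HB.instance Definition _ := GRing.LRMorphism.copy counit
  (@plift K qgroup_pres K^o _ qgroup_chrP).

Lemma counitT A B : counit (T A B) = (A == B)%:R.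
Proof. exact: (@plift_gen K qgroup_pres). Qed.

Lemma counit1 : counit 1 = 1.
Proof. exact: (rmorph1 counit). Qed.
Lemma counitM x y : counit (x * y) = counit x * counit y.
Proof. exact: (rmorphM counit). Qed.

Definition qgroup2 := tensor counit counit.

Notation "a '⊗' b" := (@tpure K qgroup qgroup counit counit a b) (at level 40).

Definition comul_gen (A B : I) : qgroup2 := \sum_C T A C ⊗ T C B.

Lemma linear_sumZ (V W : lmodType K) (f : V -> W) (J : finType)
    (k : J -> K) (x : J -> V) :
  linear f -> f (\sum_j k j *: x j) = \sum_j k j *: f (x j).
Proof.
move=> hf; elim/big_rec2: _ => [|j y z _ <-]; last exact: hf.
have := hf (-1) 0 0; rewrite scaler0 addr0 scaleN1r => {1}->.
by rewrite addNr.
Qed.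

Lemma tpure_sumZl (J : finType) (k : J -> K) (x : J -> qgroup) b :
  (\sum_j k j *: x j) ⊗ b = \sum_j k j *: (x j ⊗ b).
Proof.
apply: (linear_sumZ (f := fun a => a ⊗ b)).
exact: (tpure_bilin counit counit).1.
Qed.

Lemma tpure_sumZr (J : finType) (k : J -> K) a (x : J -> qgroup) :
  a ⊗ (\sum_j k j *: x j) = \sum_j k j *: (a ⊗ x j).
Proof.
apply: (linear_sumZ (f := fun b => a ⊗ b)).
exact: (tpure_bilin counit counit).2.
Qed.

Lemma linearZ' (V W : lmodType K) (f : V -> W) k x :
  linear f -> f (k *: x) = k *: f x.
Proof.
move=> hf; have := @linear_sumZ V W f 'I_1 (fun=> k) (fun=> x) hf.
by rewrite !big_ord1.
Qed.

Lemma tpureZl k a b : (k *: a) ⊗ b = k *: (a ⊗ b).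
Proof.
apply: (linearZ' (f := fun a => a ⊗ b)).
exact: (tpure_bilin counit counit).1.
Qed.

Lemma tpureZr k a b : a ⊗ (k *: b) = k *: (a ⊗ b).
Proof.
apply: (linearZ' (f := fun b => a ⊗ b)).
exact: (tpure_bilin counit counit).2.
Qed.

Lemma RTT' A B C D :
  \sum_(x : I * I) Rmat A B x.1 x.2 *: (T x.1 C * T x.2 D) =
  \sum_(x : I * I) Rmat x.1 x.2 C D *: (T B x.2 * T A x.1).
Proof. by have := RTT A B C D; rewrite !(pair_bigA _ (fun E F => _ *: _)). Qed.

Lemma CTT_up' A D :
  \sum_(x : I * I) Cup x.1 x.2 *: (T A x.1 * T D x.2) = Cup A D *: 1.
Proof. by rewrite -CTT_up (pair_bigA _ (fun E F => _ *: _)). Qed.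

Lemma CTT_lo' B D :
  \sum_(x : I * I) Clo x.1 x.2 *: (T x.1 B * T x.2 D) = Clo B D *: 1.
Proof. by rewrite -CTT_lo (pair_bigA _ (fun E F => _ *: _)). Qed.

Lemma comul_genM A B C D : comul_gen A B * comul_gen C D =
  \sum_(x : I * I) (T A x.1 * T C x.2) ⊗ (T x.1 B * T x.2 D).
Proof.
rewrite -(pair_bigA _ (fun E F => (T A E * T C F) ⊗ (T E B * T F D))) /=.
rewrite mulr_suml; apply: eq_bigr => E _; rewrite mulr_sumr.
by apply: eq_bigr => F _; rewrite tpureM.
Qed.

Fact comul_genP s t : qrel s t ->
  peval (fun x => comul_gen x.1 x.2) s = peval (fun x => comul_gen x.1 x.2) t.
Proof.
apply: qrel_respect => [A B C D|A D|B D].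
- rewrite !(pair_bigA _ (fun E F => _ *: _)) /=.
  under eq_bigr => x _ do rewrite comul_genM scaler_sumr.
  under [RHS]eq_bigr => x _ do rewrite comul_genM scaler_sumr.
  rewrite exchange_big /= [RHS]exchange_big /=.
  under eq_bigr => y _ do rewrite -(tpure_sumZl (fun x => Rmat A B x.1 x.2)
    (fun x => T x.1 y.1 * T x.2 y.2)) RTT' tpure_sumZl.
  rewrite exchange_big /=.
  under eq_bigr => y _ do rewrite -(tpure_sumZr (fun x => Rmat y.1 y.2 x.1 x.2)
    _ (fun x => T x.1 C * T x.2 D)) RTT' tpure_sumZr.
  rewrite [RHS](reindex (fun x : I * I => (x.2, x.1))) //=.
  by exists (fun x : I * I => (x.2, x.1)) => -[].
- rewrite (pair_bigA _ (fun E F => _ *: _)) /=.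
  under eq_bigr => x _ do rewrite comul_genM scaler_sumr.
  rewrite exchange_big /=.
  under eq_bigr => y _ do rewrite -(tpure_sumZr (fun x => Cup x.1 x.2)
    _ (fun x => T y.1 x.1 * T y.2 x.2)) CTT_up' tpureZr.
  rewrite -(tpure_sumZl (fun x => Cup x.1 x.2) (fun x => T A x.1 * T D x.2)).
  by rewrite CTT_up' tpureZl tpure1.
- rewrite (pair_bigA _ (fun E F => _ *: _)) /=.
  under eq_bigr => x _ do rewrite comul_genM scaler_sumr.
  rewrite exchange_big /=.
  under eq_bigr => y _ do rewrite -(tpure_sumZl (fun x => Clo x.1 x.2)
    (fun x => T x.1 y.1 * T x.2 y.2)) CTT_lo' tpureZl.
  rewrite -(tpure_sumZr (fun x => Clo x.1 x.2) _ (fun x => T x.1 B * T x.2 D)).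
  by rewrite CTT_lo' tpureZr tpure1.
Qed.

Definition comul : qgroup -> qgroup2 := @plift K qgroup_pres _ _ comul_genP.
HB.instance Definition _ := GRing.LRMorphism.copy comul
  (@plift K qgroup_pres _ _ comul_genP).

Lemma comulT A B : comul (T A B) = \sum_C T A C ⊗ T C B.
Proof. exact: (@plift_gen K qgroup_pres). Qed.

Lemma comul1 : comul 1 = 1.
Proof. exact: (rmorph1 comul). Qed.
Lemma comulM x y : comul (x * y) = comul x * comul y.
Proof. exact: (rmorphM comul). Qed.

Definition antipode_gen (A B : I) : qgroup :=
  \sum_C \sum_D (Cup A C * Clo D B) *: T D C.

Section AntipodeRelations.
Local Notation V := antipode_gen.
Let t : 'M[qgroup]_N.+2 := \matrix_(A, B) T A B.
Let v : 'M[qgroup]_N.+2 := \matrix_(A, B) V A B.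
Let CU : 'M[qgroup]_N.+2 := \matrix_(A, B) (Cup A B)%:A.
Let CL : 'M[qgroup]_N.+2 := \matrix_(A, B) (Clo A B)%:A.

Let mulZr (x : qgroup) k : x * k%:A = k *: x.
Proof. by rewrite -scalerAr mulr1. Qed.
Let mulZl (x : qgroup) k : k%:A * x = k *: x.
Proof. by rewrite -scalerAl mul1r. Qed.

Let deltaA (A B : I) : (A == B)%:R%:A = (A == B)%:R :> qgroup.
Proof. by case: eqP; rewrite ?scale1r ?scale0r. Qed.

Let CUL : CU *m CL = 1%:M.
Proof.
apply/matrixP => A B; rewrite !mxE -deltaA -Cup_Clo scaler_suml.
by apply: eq_bigr => C _; rewrite !mxE mulZl scalerA.
Qed.

Let CLU : CL *m CU = 1%:M.
Proof.
apply/matrixP => A B; rewrite !mxE -deltaA -Clo_Cup scaler_suml.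
by apply: eq_bigr => C _; rewrite !mxE mulZl scalerA.
Qed.

Let CULt : CU^T *m CL^T = 1%:M.
Proof.
apply/matrixP => A B; rewrite !mxE eq_sym -deltaA -Clo_Cup scaler_suml.
by apply: eq_bigr => C _; rewrite !mxE mulZl scalerA mulrC.
Qed.

Let CTU : t *m CU *m t^T = CU.
Proof.
apply/matrixP => A D; rewrite !mxE -CTT_up exchange_big /=.
apply: eq_bigr => C _; rewrite !mxE mulr_suml.
by apply: eq_bigr => B _; rewrite !mxE mulZr scalerAl.
Qed.

Let CTL : t^T *m CL *m t = CL.
Proof.
apply/matrixP => A D; rewrite !mxE -CTT_lo exchange_big /=.
apply: eq_bigr => C _; rewrite !mxE mulr_suml.
by apply: eq_bigr => B _; rewrite !mxE mulZr scalerAl.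
Qed.

Let vE : v = CU *m t^T *m CL.
Proof.
apply/matrixP => A B; rewrite !mxE /antipode_gen exchange_big /=.
apply: eq_bigr => D _; rewrite !mxE mulr_suml.
by apply: eq_bigr => C _; rewrite !mxE mulZr mulZl scalerA mulrC.
Qed.

Let vtE : v^T = CL^T *m t *m CU^T.
Proof.
apply/matrixP => A B; rewrite !mxE /antipode_gen; apply: eq_bigr => C _.
rewrite !mxE mulr_suml; apply: eq_bigr => D _.
by rewrite !mxE mulZr mulZl scalerA mulrC.
Qed.

Let vt : v *m t = 1%:M.
Proof. by rewrite vE -!mulmxA [t^T *m _]mulmxA CTL. Qed.

Let tv : t *m v = 1%:M.
Proof. by rewrite vE !mulmxA CTU. Qed.

Lemma antipode_genl A B : \sum_C V A C * T C B = (A == B)%:R.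
Proof.
have /matrixP/(_ A B) := vt; rewrite !mxE => <-.
by apply: eq_bigr => C _; rewrite !mxE.
Qed.

Lemma antipode_genr A B : \sum_C T A C * V C B = (A == B)%:R.
Proof.
have /matrixP/(_ A B) := tv; rewrite !mxE => <-.
by apply: eq_bigr => C _; rewrite !mxE.
Qed.

Lemma antipode_gen_up A D :
  \sum_B \sum_C Cup B C *: (V D C * V A B) = Cup A D *: 1.
Proof.
have : v *m CU^T *m v^T = CU^T.
  by rewrite vtE !mulmxA -(mulmxA v) CULt mulmx1 vt mul1mx.
move=> /matrixP/(_ D A); rewrite !mxE => <-; apply: eq_bigr => B _.
rewrite !mxE mulr_suml; apply: eq_bigr => C _.
by rewrite !mxE mulZr scalerAl.
Qed.

Lemma antipode_gen_lo B D :
  \sum_A \sum_C Clo A C *: (V C D * V A B) = Clo B D *: 1.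
Proof.
have : v^T *m CL^T *m v = CL^T.
  by rewrite vtE -!mulmxA [CU^T *m _]mulmxA CULt mul1mx tv mulmx1.
move=> /matrixP/(_ D B); rewrite !mxE => <-; apply: eq_bigr => A _.
rewrite !mxE mulr_suml; apply: eq_bigr => C _.
by rewrite !mxE mulZr scalerAl.
Qed.
End AntipodeRelations.

Lemma exchange_rel_inv (J : finType) (k : J -> J -> K)
    (X X' Y Y' : J -> J -> qgroup) :
  (forall i l, \sum_j k i j *: X j l = \sum_j k j l *: X' i j) ->
  (forall i l, \sum_j X i j * Y j l = (i == l)%:R) ->
  (forall i l, \sum_j Y' i j * X' j l = (i == l)%:R) ->
  forall i l, \sum_j k i j *: Y j l = \sum_j k j l *: Y' i j.
Proof.
move=> h hX hY i l.
have dl (F : J -> qgroup) m : \sum_n (m == n)%:R * F n = F m.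
  rewrite (bigD1 m) //= eqxx mul1r big1 ?addr0 // => n.
  by rewrite eq_sym => /negPf ->; rewrite mul0r.
have dr (F : J -> qgroup) m : \sum_n F n * (n == m)%:R = F m.
  rewrite (bigD1 m) //= eqxx mulr1 big1 ?addr0 // => n.
  by move=> /negPf ->; rewrite mulr0.
rewrite -(dl (fun i => \sum_j k i j *: Y j l)).
under eq_bigr => m _ do rewrite -hY mulr_suml.
rewrite exchange_big /=; apply: eq_bigr => n _.
under eq_bigr => m _ do rewrite -mulrA.
rewrite -mulr_sumr -[in RHS](mulr1 (Y' i n)) scalerAr; congr (_ * _).
under eq_bigr => m _ do rewrite mulr_sumr.
rewrite exchange_big /=.
transitivity (\sum_j (\sum_m k n m *: X m j) * Y j l).
  apply: eq_bigr => j _; rewrite h mulr_suml.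
  by apply: eq_bigr => m _; rewrite -scalerAr scalerAl.
under eq_bigr => j _ do rewrite mulr_suml.
rewrite exchange_big /=.
under eq_bigr => m _.
  under eq_bigr => j _ do rewrite -scalerAl.
  rewrite -scaler_sumr hX.
  over.
rewrite (bigD1 l) //= eqxx big1 ?addr0 // => m /negPf ->.
exact: scaler0.
Qed.

Fact antipode_genP s u : qrel s u ->
  peval (fun x => antipode_gen x.1 x.2 : qgroup^c) s =
  peval (fun x => antipode_gen x.1 x.2 : qgroup^c) u.
Proof.
apply: (@qrel_respect qgroup^c antipode_gen) => [A B C D|A D|B D]; last 2 first.
- exact: antipode_gen_up.
- exact: antipode_gen_lo.
pose X (x y : I * I) := T x.1 y.1 * T x.2 y.2.
pose X' (x y : I * I) := T x.2 y.2 * T x.1 y.1.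
pose Y (x y : I * I) := antipode_gen x.2 y.2 * antipode_gen x.1 y.1.
pose Y' (x y : I * I) := antipode_gen x.1 y.1 * antipode_gen x.2 y.2.
have := @exchange_rel_inv _ (fun x y => Rmat x.1 x.2 y.1 y.2) X X' Y Y' _ _ _
  (A, B) (C, D).
rewrite /Y /Y' /= !(pair_bigA _ (fun E F => _ *: _)) /=; apply.
- by move=> [E F] [G H]; apply: RTT'.
- move=> [E F] [G H]; rewrite /X /= -(pair_bigA _
    (fun P Q => T E P * T F Q * (antipode_gen Q H * antipode_gen P G))) /=.
  transitivity (\sum_P T E P * (F == H)%:R * antipode_gen P G).
    apply: eq_bigr => P _; rewrite -antipode_genr mulr_sumr mulr_suml.
    by apply: eq_bigr => Q _; rewrite !mulrA.
  rewrite xpair_eqE; case: (F == H); last first.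
    by rewrite andbF big1 // => P _; rewrite mulr0 mul0r.
  rewrite andbT -antipode_genr; apply: eq_bigr => P _.
  by rewrite mulr1.
- move=> [E F] [G H]; rewrite /X' /= -(pair_bigA _
    (fun P Q => antipode_gen E P * antipode_gen F Q * (T Q H * T P G))) /=.
  transitivity (\sum_P antipode_gen E P * (F == H)%:R * T P G).
    apply: eq_bigr => P _; rewrite -antipode_genl mulr_sumr mulr_suml.
    by apply: eq_bigr => Q _; rewrite !mulrA.
  rewrite xpair_eqE; case: (F == H); last first.
    by rewrite andbF big1 // => P _; rewrite mulr0 mul0r.
  rewrite andbT -antipode_genl; apply: eq_bigr => P _.
  by rewrite mulr1.
Qed.

(* kappa as an algebra map to the opposite algebra, i.e. an algebra
   antihomomorphism. *)
Definition antipode_op : qgroup -> qgroup^c :=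
  @plift K qgroup_pres _ _ antipode_genP.
HB.instance Definition _ := GRing.LRMorphism.copy antipode_op
  (@plift K qgroup_pres _ _ antipode_genP).

Definition antipode : qgroup -> qgroup := antipode_op.
Fact antipode_linear : linear antipode.
Proof. exact: (linearP antipode_op). Qed.
HB.instance Definition _ :=
  GRing.isLinear.Build K qgroup qgroup *:%R antipode antipode_linear.

Lemma antipodeT A B :
  antipode (T A B) = \sum_C \sum_D (Cup A C * Clo D B) *: T D C.
Proof. exact: (@plift_gen K qgroup_pres qgroup^c _ antipode_genP (A, B)). Qed.

Lemma antipode1 : antipode 1 = 1.
Proof. exact: (rmorph1 antipode_op). Qed.

Lemma antipodeM x y : antipode (x * y) = antipode y * antipode x.
Proof. exact: (rmorphM antipode_op). Qed.

(* Functionals on S_{q,r}(N+2); their product is convolution. *)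
Definition hdual := functional qgroup.
HB.instance Definition _ := GRing.Lmodule.on hdual.

Definition conv (phi psi : hdual) : hdual :=
  (tensf counit counit phi psi \o comul : {linear _ -> _}).

Definition dual_unit : hdual := counit.

Lemma conv1 phi psi : conv phi psi 1 = phi 1 * psi 1.
Proof. by rewrite /conv /= comul1 -(tpure1 counit counit) tlift_pure. Qed.

(* phi (- * a) *)
Definition ract_fun (a : qgroup) (phi : hdual) : qgroup -> K^o :=
  fun x => phi (x * a).
Fact ract_linear a phi : linear (ract_fun a phi).
Proof. by move=> k x y; rewrite /ract_fun mulrDl -scalerAl linearP. Qed.
HB.instance Definition _ a phi :=
  GRing.isLinear.Build K qgroup K^o *:%R (ract_fun a phi) (ract_linear a phi).
Definition ract a phi : hdual := ract_fun a phi.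

Lemma convMT phi psi x A B : conv phi psi (x * T A B) =
  \sum_C conv (ract (T A C) phi) (ract (T C B) psi) x.
Proof.
rewrite /conv /= comulM comulT mulr_sumr linear_sum.
by apply: eq_bigr => C _; apply: (tlift_mulr (tensf_bilin phi psi)).
Qed.

Lemma convPl k phi1 phi2 psi :
  conv (k *: phi1 + phi2) psi = k *: conv phi1 psi + conv phi2 psi.
Proof.
apply: functionalP => x.
rewrite [RHS]/= -[RHS](tens_act_lin _ k (fun a b => phi1 a * psi b : K^o)
  (fun a b => phi2 a * psi b : K^o)) /=.
congr tens_act; apply/funext => a; apply/funext => b.
by rewrite functional_add functional_scale mulrDl -mulrA.
Qed.

Lemma convPr k phi psi1 psi2 :
  conv phi (k *: psi1 + psi2) = k *: conv phi psi1 + conv phi psi2.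
Proof.
apply: functionalP => x.
rewrite [RHS]/= -[RHS](tens_act_lin _ k (fun a b => phi a * psi1 b : K^o)
  (fun a b => phi a * psi2 b : K^o)) /=.
congr tens_act; apply/funext => a; apply/funext => b.
by rewrite functional_add functional_scale mulrDr mulrCA.
Qed.

Fact convDl : left_distributive conv +%R.
Proof. by move=> f g h; rewrite -[f in LHS]scale1r convPl scale1r. Qed.
Fact convDr : right_distributive conv +%R.
Proof. by move=> f g h; rewrite -[g in LHS]scale1r convPr scale1r. Qed.
Lemma conv0l psi : conv 0 psi = 0.
Proof. by apply: (addIr (conv 0 psi)); rewrite -convDl !add0r. Qed.
Lemma conv0r phi : conv phi 0 = 0.
Proof. by apply: (addIr (conv phi 0)); rewrite -convDr !add0r. Qed.

Lemma conv_suml (J : finType) (f : J -> hdual) psi x :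
  conv (\sum_j f j) psi x = \sum_j conv (f j) psi x.
Proof.
rewrite -functional_sum.
by rewrite (big_morph (conv^~ psi) (fun a b => convDl a b psi) (conv0l psi)).
Qed.
Lemma conv_sumr (J : finType) phi (f : J -> hdual) x :
  conv phi (\sum_j f j) x = \sum_j conv phi (f j) x.
Proof.
rewrite -functional_sum.
by rewrite (big_morph (conv phi) (convDr phi) (conv0r phi)).
Qed.

Lemma ract_conv A B phi psi : ract (T A B) (conv phi psi) =
  \sum_C conv (ract (T A C) phi) (ract (T C B) psi).
Proof.
by apply: functionalP => x; rewrite functional_sum -convMT.
Qed.

Fact convA : associative conv.
Proof.
move=> f g h; apply: functionalP => x.
elim/qgroup_ind: x f g h => [|k x y hx hy|x A B hx] f g h.
- by rewrite !conv1 mulrA.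
- by rewrite !linearP hx hy.
- rewrite !convMT.
  under eq_bigr => C _ do rewrite ract_conv conv_sumr.
  under [RHS]eq_bigr => C _ do rewrite ract_conv conv_suml.
  rewrite exchange_big /=; apply: eq_bigr => C _; apply: eq_bigr => D _.
  exact: hx.
Qed.

Lemma ract_dual_unit A B : ract (T A B) dual_unit = (A == B)%:R *: dual_unit.
Proof.
apply: functionalP => x.
rewrite functional_scale /= /ract_fun counitM counitT.
exact: mulrC.
Qed.

Fact conv1l : left_id dual_unit conv.
Proof.
move=> f; apply: functionalP => x.
elim/qgroup_ind: x f => [|k x y hx hy|x A B hx] f.
- by rewrite conv1 [dual_unit 1]counit1 mul1r.
- by rewrite !linearP hx hy.
- rewrite convMT -[RHS](hx (ract (T A B) f)).
  rewrite (bigD1 A) // ract_dual_unit eqxx scale1r big1 => [|C].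
    exact: addr0.
  by rewrite eq_sym ract_dual_unit => /negPf ->; rewrite scale0r conv0l.
Qed.

Fact conv1r : right_id dual_unit conv.
Proof.
move=> f; apply: functionalP => x.
elim/qgroup_ind: x f => [|k x y hx hy|x A B hx] f.
- by rewrite conv1 [dual_unit 1]counit1 mulr1.
- by rewrite !linearP hx hy.
- rewrite convMT -[RHS](hx (ract (T A B) f)).
  rewrite (bigD1 B) // ract_dual_unit eqxx scale1r big1 => [|C].
    exact: addr0.
  by rewrite ract_dual_unit => /negPf ->; rewrite scale0r conv0r.
Qed.

Fact dual_unit_neq0 : dual_unit != 0.
Proof.
apply/eqP => /(congr1 (fun f : hdual => f 1)).
by rewrite [LHS]counit1 => /eqP; rewrite functional_zero oner_eq0.
Qed.

HB.instance Definition _ := GRing.Zmodule_isNzRing.Build hdual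
  convA conv1l conv1r convDl convDr dual_unit_neq0.

Fact hdual_scalerAl k (f g : hdual) : k *: (f * g) = (k *: f) * g.
Proof.
have := convPl k f 0 g; rewrite addr0 conv0l addr0 => h.
exact: esym h.
Qed.
Fact hdual_scalerAr k (f g : hdual) : k *: (f * g) = f * (k *: g).
Proof.
have := convPr k f g 0; rewrite addr0 conv0r addr0 => h.
exact: esym h.
Qed.
HB.instance Definition _ :=
  GRing.Lmodule_isLalgebra.Build K hdual hdual_scalerAl.
HB.instance Definition _ :=
  GRing.Lalgebra_isAlgebra.Build K hdual hdual_scalerAr.

(* The co-structures dual to those of S_{q,r}(N+2): Delta'(phi) = phi o m as a
   functional on S (x) S, epsilon'(phi) = phi(I), kappa'(phi) = phi o kappa. *)

Fact mul_bilin : bilin (fun x y : qgroup => x * y).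
Proof.
by split=> z k x y; rewrite ?mulrDl ?mulrDr -?scalerAl -?scalerAr.
Qed.
Definition tmul : qgroup2 -> qgroup := tlift mul_bilin.
HB.instance Definition _ := GRing.Linear.copy tmul (tlift mul_bilin).

Definition dual_comul (phi : hdual) : functional qgroup2 :=
  (phi \o tmul : {linear _ -> _}).
Definition dual_counit (phi : hdual) : K := phi 1.
Definition dual_antipode (phi : hdual) : hdual :=
  (phi \o antipode : {linear _ -> _}).

Lemma dual_comul_pure phi x y : dual_comul phi (x ⊗ y) = phi (x * y).
Proof. by congr (phi _); apply: tlift_pure. Qed.

(* phi (x) psi as a functional on S (x) S *)
Definition htens (phi psi : hdual) : functional qgroup2 :=
  tensf counit counit phi psi.

(* G is a Hopf algebra of functionals: a unital subalgebra of the convolution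
   algebra with Delta'(G) in G (x) G and kappa'(G) in G, where G (x) G is
   identified with its image in the functionals on S (x) S.  The Hopf algebra
   axioms are then dual to those of S_{q,r}(N+2). *)
Definition hopf_functionals (G : hdual -> Prop) : Prop :=
  [/\ G 1 /\ (forall k phi psi, G phi -> G psi -> G (k *: phi + psi)),
      forall phi psi, G phi -> G psi -> G (phi * psi),
      forall phi, G phi -> exists n (phi1 phi2 : 'I_n -> hdual),
        (forall i, G (phi1 i) /\ G (phi2 i)) /\
        dual_comul phi = \sum_i htens (phi1 i) (phi2 i)
    & forall phi, G phi -> G (dual_antipode phi)].

(* Functionals with prescribed values on generators, extended to products by
   L^A_B(xy) = L^A_C(x) L^C_B(y); these conditions determine them uniquely. *)
Definition L_functionals (val : I -> I -> I -> I -> K)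
    (L : I -> I -> hdual) : Prop :=
  [/\ forall A B C D, L A B (T C D) = val A B C D,
      forall A B, L A B 1 = (A == B)%:R
    & forall A B x y, L A B (x * y) = \sum_C L A C x * L C B y].
Definition is_Lplus := L_functionals (fun A B C D => Rmat C A D B).
Definition is_Lminus := L_functionals (fun A B C D => Rinv A C B D).

(* The indices 1, ..., N. *)
Definition inner (A : I) : bool := (A != ord0) && (A != ord_max).

(* The block-diagonal part of L^+. *)
Definition block_diag (L : I -> I -> hdual) (A B : I) : hdual :=
  if (A == B) || inner A && inner B then L A B else 0.

(* The block-diagonal analogue of R. *)
Definition calR (A B C D : I) : K :=
  if [&& inner A, inner B, inner C & inner D] || (C == A) && (D == B)
  then Rmat A B C D else 0.

(* U_{q,r}(s(N+2)) *)
Definition U_alg (Lplus Lminus : I -> I -> hdual) : hdual -> Prop :=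
  subalg_gen (fun phi => [\/ phi = dual_unit, exists A B, phi = Lplus A B
                           | exists A B, phi = Lminus A B]).

Definition IU_alg (Lplus Lminus : I -> I -> hdual) : hdual -> Prop :=
  subalg_gen (fun phi => phi = dual_unit \/
    [\/ exists A B, phi = Lminus A B,
        exists a b, [/\ inner a, inner b & phi = Lplus a b],
        phi = Lplus ord0 ord0 | phi = Lplus ord_max ord_max]).

(* M_{12} X_2 Y_1 = Y_1 X_2 M_{12} *)
Definition exchange_rel (M : I -> I -> I -> I -> K) (X Y : I -> I -> hdual) :=
  forall A B C D,
    \sum_E \sum_F M A B E F *: (X F D * Y E C) =
    \sum_E \sum_F M E F C D *: (Y A E * X B F).

(* The orthogonality (symplecticity) conditions. *)
Definition metric_rel (L : I -> I -> hdual) :=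
  (forall C D, \sum_A \sum_B Cup A B *: (L C B * L D A) = Cup D C *: dual_unit) /\
  (forall C D, \sum_A \sum_B Clo A B *: (L B C * L A D) = Clo D C *: dual_unit).

Definition costructure_rel (L : I -> I -> hdual) :=
  [/\ forall A B, dual_comul (L A B) = \sum_G htens (L A G) (L G B),
      forall A B, dual_counit (L A B) = (A == B)%:R
    & forall A B, dual_antipode (L A B) =
        \sum_C \sum_D (Cup D A * Clo B C) *: L C D].

End QuantumGroup.

(* Main.v *)
(* Each L^{+-} is a matrix representation x |-> (L^A_B(x)) of S_{q,r}(N+2), so a
   relation between (products of) such matrices holds as soon as it holds on the
   generators T.  Evaluating at T^C_D kappa(T^D_E) shows that
   L^{+-A}_C(T^G_H) = L^{-+G}_H(kappa(T^A_C)); this duality turns the relations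
   for L^{+-} on generators into L^{-+} o kappa applied to the relations of
   S_{q,r}(N+2), and the Yang-Baxter equation is never needed explicitly.
   Finally R and C preserve the weight of the torus acting on the indices
   circ and bullet, while L^+ only raises it: the relations for cal L^+ are the
   weight-zero components of those for L^+. *)
From HB Require Import structures.
Require Import Defs.
From mathcomp Require Import all_boot all_order all_algebra.
From mathcomp Require Import boolp reals complex.
From mathcomp Require Import zify.

Set Implicit Arguments.
Unset Strict Implicit.
Unset Printing Implicit Defensive.

Import GRing.Theory.
Local Open Scope ring_scope.

(** * Functionals on a tensor product are determined by pure tensors *)

Section TensorInduction.
Variables (K : fieldType) (A B : algType K).
Variables (chi : {lrmorphism A -> K^o}) (psi : {lrmorphism B -> K^o}).
Local Notation tpure := (@tpure K A B chi psi).

Lemma tensor_ind (Q : tensor chi psi -> Prop) :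
  (forall k x y, Q x -> Q y -> Q (k *: x + y)) ->
  (forall a b, Q (tpure a b)) -> forall x, Q x.
Proof.
move=> QD Qp.
(* A pure tensor on the right absorbs the generators, and quantifying over [Q] lets the product case
   use the predicate z |-> Q (t z). *)
suff h t : forall Q : tensor chi psi -> Prop,
    (forall k x y, Q x -> Q y -> Q (k *: x + y)) ->
    (forall a b, Q (tpure a b)) ->
    forall a b, Q (@pclass K (tens_pres chi psi) t * tpure a b).
  elim/(@pclass_ind K (tens_pres chi psi)) => t.
  by rewrite -[pclass _]mulr1 -tpure1; apply: h.
elim: t => [k|[x|y]|t IHt u IHu|t IHt u IHu] {}Q {}QD {}Qp a b.
- rewrite (@pclassC K (tens_pres chi psi)) -scalerAl mul1r.
  (* The summand 0 arises as (-1) v + v with v pure. *)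
  have := QD k _ _ (Qp a b) (QD (-1) _ _ (Qp a b) (Qp a b)).
  by rewrite scaleN1r addNr addr0.
- rewrite tpureE mulrA -(@pclassM K (tens_pres chi psi)).
  by rewrite -(tens_relP chi psi (tens_lM _ x a)) -tpureE.
- rewrite tpureE mulrA -(@pclassM K (tens_pres chi psi)).
  rewrite -(tens_relP chi psi (tens_comm a y)).
  rewrite (@pclassM K (tens_pres chi psi)) -mulrA.
  rewrite -(@pclassM K (tens_pres chi psi)).
  by rewrite -(tens_relP chi psi (tens_rM _ y b)) -tpureE.
- rewrite (@pclassD K (tens_pres chi psi)) mulrDl -[X in X + _]scale1r.
  exact: QD (IHt Q QD Qp a b) (IHu Q QD Qp a b).
- rewrite (@pclassM K (tens_pres chi psi)) -mulrA.
  apply: (IHu (fun z => Q (pclass t * z))) => [k x y Qx Qy|c d].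
    by rewrite mulrDr -scalerAr; apply: QD.
  exact: (IHt Q).
Qed.

Lemma tensor_functionalP (f g : functional (tensor chi psi)) :
  (forall a b, f (tpure a b) = g (tpure a b)) -> f = g.
Proof.
move=> efg; apply: functionalP; apply: tensor_ind => // k x y fx fy.
by rewrite !linearP fx fy.
Qed.
End TensorInduction.

(** * Convolution products and the co-structures of the dual *)

Section Dual.
Variables (K : fieldType) (S : series) (N : nat) (p : qparams K S N).
Local Notation I := 'I_N.+2.
Local Notation T := (T p).
Local Notation Cup := (Cup p).
Local Notation Clo := (Clo p).
Local Notation Rmat := (Rmat p).
Local Notation Rinv := (Rinv p).
Local Notation hdual := (hdual p).
Local Notation qgroup := (qgroup p).
Local Notation tpure :=
  (@tpure K qgroup qgroup (@counit K S N p) (@counit K S N p)).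
Implicit Types (phi psi : hdual) (x y : qgroup).

Lemma hlinearP phi k x y : phi (k *: x + y) = k * phi x + phi y.
Proof. exact: linearP. Qed.

Lemma hmul1E phi psi : (phi * psi) 1 = phi 1 * psi 1.
Proof. exact: conv1. Qed.

Lemma hmulMT phi psi x A B :
  (phi * psi) (x * T A B) = \sum_C (ract (T A C) phi * ract (T C B) psi) x.
Proof. exact: convMT. Qed.

Lemma hmulT phi psi A B :
  (phi * psi) (T A B) = \sum_C phi (T A C) * psi (T C B).
Proof.
rewrite -[T A B]mul1r hmulMT; apply: eq_bigr => C _.
by rewrite hmul1E /= /ract_fun !mul1r.
Qed.

Lemma functional_sumZ (J : finType) (k : J -> K) (f : J -> hdual) x :
  (\sum_j k j *: f j) x = \sum_j k j * f j x.
Proof. by rewrite functional_sum. Qed.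

(* The product of functionals is dual to the algebra map Delta; phi1, phi2 and
   psi1, psi2 stand for the Sweedler components of Delta'(phi), Delta'(psi). *)
Lemma hmulM (J J' : finType) phi psi (phi1 phi2 : J -> hdual)
    (psi1 psi2 : J' -> hdual) :
  (forall x y, phi (x * y) = \sum_i phi1 i x * phi2 i y) ->
  (forall x y, psi (x * y) = \sum_i psi1 i x * psi2 i y) ->
  forall x y, (phi * psi) (x * y) =
    \sum_i \sum_j (phi1 i * psi1 j) x * (phi2 i * psi2 j) y.
Proof.
move=> hphi hpsi x y; move: x.
elim/qgroup_ind: y phi psi phi2 psi2 hphi hpsi
    => [|k y z hy hz|y A B hy] phi psi phi2 psi2 hphi hpsi x.
- have -> : phi = \sum_i (phi2 i 1 : K) *: phi1 i.
    apply: functionalP => z; rewrite functional_sumZ -[z in LHS]mulr1 hphi.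
    by apply: eq_bigr => i _; rewrite mulrC.
  have -> : psi = \sum_i (psi2 i 1 : K) *: psi1 i.
    apply: functionalP => z; rewrite functional_sumZ -[z in LHS]mulr1 hpsi.
    by apply: eq_bigr => i _; rewrite mulrC.
  rewrite mulr1 mulr_suml functional_sum; apply: eq_bigr => i _.
  rewrite mulr_sumr functional_sum; apply: eq_bigr => j _.
  rewrite -scalerAl -scalerAr !functional_scale hmul1E mulrA.
  exact: mulrC.
- rewrite mulrDr -scalerAr hlinearP (hy _ _ _ _ hphi hpsi).
  rewrite (hz _ _ _ _ hphi hpsi) mulr_sumr -big_split.
  apply: eq_bigr => i _; rewrite mulr_sumr -big_split.
  by apply: eq_bigr => j _; rewrite hlinearP mulrDr; congr (_ + _); apply: mulrCA.
- rewrite mulrA hmulMT.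
  under eq_bigr => C _.
    rewrite (hy _ _ (fun i => ract (T A C) (phi2 i))
                    (fun i => ract (T C B) (psi2 i))); first over.
      by move=> u v; rewrite /= /ract_fun -mulrA hphi.
    by move=> u v; rewrite /= /ract_fun -mulrA hpsi.
  rewrite exchange_big; apply: eq_bigr => i _.
  rewrite exchange_big; apply: eq_bigr => j _.
  by rewrite hmulMT mulr_sumr.
Qed.

(** Left counterpart of [ract]: kappa reverses products, so a generator split off on the right of x
    appears on the left of kappa(x). *)
Definition lact_fun (a : qgroup) phi : qgroup -> K^o := fun x => phi (a * x).
Fact lact_linear a phi : linear (lact_fun a phi).
Proof. by move=> k x y; rewrite /lact_fun mulrDr -scalerAr linearP. Qed.
HB.instance Definition _ a phi :=
  GRing.isLinear.Build K qgroup K^o *:%R (lact_fun a phi) (lact_linear a phi).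
Definition lact a phi : hdual := lact_fun a phi.

Lemma htens_pure phi psi a b : htens phi psi (tpure a b) = phi a * psi b.
Proof. exact: tlift_pure. Qed.

Lemma tensf_mull phi psi a b (t : qgroup2 p) :
  htens phi psi (tpure a b * t) = htens (lact a phi) (lact b psi) t.
Proof.
elim/tensor_ind: t => [k x y hx hy|x y].
  by rewrite mulrDr -scalerAr !linearP hx hy.
by rewrite tpureM !htens_pure.
Qed.

(** kappa(T) is the transpose of T between two factors of the metric, hence the flip of the tensor
    factors. [W] and [U] absorb the outer metric factors; the inner ones cancel by [Clo_Cup]. *)
Lemma comul_antipode_gen A B : comul (antipode_gen p A B) =
  \sum_C tpure (antipode_gen p C B) (antipode_gen p A C).
Proof.
pose W C := \sum_D Clo D B *: T D C; pose U C := \sum_D Cup A D *: T C D.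
have VW C : antipode_gen p C B = \sum_D Cup C D *: W D.
  apply: eq_bigr => D _; rewrite scaler_sumr.
  by apply: eq_bigr => E _; rewrite scalerA.
have VU C : antipode_gen p A C = \sum_D Clo D C *: U D.
  rewrite /antipode_gen exchange_big; apply: eq_bigr => D _.
  by rewrite scaler_sumr; apply: eq_bigr => E _; rewrite scalerA mulrC.
transitivity (\sum_C tpure (W C) (U C)).
  rewrite linear_sum; under eq_bigr => C _.
    rewrite linear_sum; under eq_bigr => D _ do
      rewrite linearZ /= comulT scaler_sumr.
    rewrite exchange_big; over.
  rewrite exchange_big; apply: eq_bigr => E _.
  rewrite tpure_sumZr; apply: eq_bigr => C _.
  rewrite tpure_sumZl scaler_sumr; apply: eq_bigr => D _.
  by rewrite scalerA.
under [RHS]eq_bigr => C _.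
  rewrite VW VU tpure_sumZl; under eq_bigr => D _.
    rewrite tpure_sumZr scaler_sumr; under eq_bigr => E _ do rewrite scalerA.
    over.
  over.
rewrite exchange_big; apply: eq_bigr => D _ /=.
rewrite exchange_big -[LHS](sum_delta (fun E => tpure (W D) (U E))).
apply: eq_bigr => E _; rewrite -scaler_suml -(Clo_Cup p).
by congr (_ *: _); apply: eq_bigr => C _; rewrite mulrC.
Qed.

Lemma antipode_TE A B : antipode (T A B) = antipode_gen p A B.
Proof. exact: antipodeT. Qed.

Lemma hmulVM phi psi A B x : (phi * psi) (antipode (T A B) * x) =
  \sum_C (lact (antipode (T C B)) phi * lact (antipode (T A C)) psi) x.
Proof.
rewrite -[LHS]/(htens phi psi (comul _)) comulM antipode_TE comul_antipode_gen.
rewrite mulr_suml linear_sum; apply: eq_bigr => C _.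
by rewrite !antipode_TE tensf_mull.
Qed.

(** Dual to the flip of Delta by kappa; the induction splits generators off x one at a time. *)
Lemma dual_antipodeM phi psi :
  dual_antipode (phi * psi) = dual_antipode psi * dual_antipode phi.
Proof.
apply: functionalP => x; rewrite -[LHS]/((phi * psi) (antipode x)).
elim/qgroup_ind: x phi psi => [|k x y hx hy|x A B hx] phi psi.
- rewrite antipode1 !hmul1E -[dual_antipode _ 1]/(psi (antipode 1)).
  by rewrite -[dual_antipode _ 1]/(phi (antipode 1)) antipode1 mulrC.
- by rewrite linearP !hlinearP hx hy.
- rewrite antipodeM hmulVM hmulMT; apply: eq_bigr => C _; rewrite hx.
  congr ((_ * _ : hdual) x); apply: functionalP => y.
    by rewrite /= /lact_fun /ract_fun /= antipodeM.
  by rewrite /= /lact_fun /ract_fun /= antipodeM.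
Qed.

Lemma hlinearZ phi k x : phi (k *: x) = k * phi x.
Proof. exact: linearZ. Qed.

Lemma hlinear_sum (J : finType) phi (k : J -> K) (y : J -> qgroup) :
  phi (\sum_j k j *: y j) = \sum_j k j * phi (y j).
Proof. by rewrite linear_sum; apply: eq_bigr => j _; rewrite linearZ. Qed.

(** * Matrix representations and their intertwiners *)

Definition matrix_rep (J : finType) (X : J -> J -> hdual) : Prop :=
  (forall i j, X i j 1 = (i == j)%:R) /\
  (forall i j x y, X i j (x * y) = \sum_k X i k x * X k j y).

(** Multiplicativity propagates the identity: M X(xT) = M X(x) X(T) = X'(x) M X(T) = X'(x) X'(T) M.
    Two index types are allowed so that the metric can relate to the trivial representation. *)
Lemma matrix_rep_intertwine (J J' : finType) (M : J -> J' -> K)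
    (X : J' -> J' -> hdual) (X' : J -> J -> hdual) :
  matrix_rep X -> matrix_rep X' ->
  (forall A B i l, \sum_j M i j * X j l (T A B) =
                   \sum_j M j l * X' i j (T A B)) ->
  forall i l, \sum_j M i j *: X j l = \sum_j M j l *: X' i j.
Proof.
move=> [X1 XM] [X'1 X'M] h i l; apply: functionalP => x.
rewrite !functional_sumZ.
elim/qgroup_ind: x i l => [|k x y hx hy|x A B hx] i l.
- rewrite (bigD1 l) //= X1 eqxx mulr1 big1 => [|j /negPf jl]; last first.
    by rewrite X1 jl mulr0.
  rewrite (bigD1 i) //= X'1 eqxx mulr1 big1 // => j.
  by rewrite X'1 eq_sym => /negPf ->; rewrite mulr0.
- transitivity (k * (\sum_j M i j * X j l x) + \sum_j M i j * X j l y).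
    rewrite mulr_sumr -big_split; apply: eq_bigr => j _.
    by rewrite hlinearP mulrDr mulrCA.
  rewrite hx hy mulr_sumr -big_split; apply: eq_bigr => j _.
  by rewrite hlinearP mulrDr mulrCA.
- transitivity (\sum_m (\sum_j M i j * X j m x) * X m l (T A B)).
    under [RHS]eq_bigr => m _ do rewrite mulr_suml.
    rewrite exchange_big; apply: eq_bigr => j _.
    rewrite XM mulr_sumr; apply: eq_bigr => m _; exact: mulrA.
  under eq_bigr => m _ do rewrite hx mulr_suml.
  rewrite exchange_big /=.
  transitivity (\sum_j (X' i j x : K) * (\sum_m M j m * X m l (T A B))).
    apply: eq_bigr => j _; rewrite mulr_sumr; apply: eq_bigr => m _.
    by rewrite mulrCA mulrA.
  transitivity (\sum_j (X' i j x : K) * (\sum_m M m l * X' j m (T A B))).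
    by apply: eq_bigr => j _; congr (_ * _); apply: h.
  under [LHS]eq_bigr => j _ do rewrite mulr_sumr.
  rewrite exchange_big; apply: eq_bigr => j _.
  rewrite X'M mulr_sumr; apply: eq_bigr => m _; exact: mulrCA.
Qed.

Lemma matrix_rep_mul (J J' : finType) (X : J -> J -> hdual)
    (Y : J' -> J' -> hdual) : matrix_rep X -> matrix_rep Y ->
  matrix_rep (fun i j : J * J' => X i.1 j.1 * Y i.2 j.2).
Proof.
move=> [X1 XM] [Y1 YM]; split=> [[i i'] [j j']|i j x y].
  by rewrite hmul1E X1 Y1 xpair_eqE /= -mulnb natrM.
rewrite (hmulM (XM _ _) (YM _ _)).
exact: (pair_bigA _ (fun k l => (X i.1 k * Y i.2 l) x * (X k j.1 * Y l j.2) y)).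
Qed.

(** The convolution order stays X, Y while the index pair is swapped: this puts L_2 L_1 and L_1 L_2
    on the same index set, as the exchange relation requires. *)
Lemma matrix_rep_mul' (J J' : finType) (X : J -> J -> hdual)
    (Y : J' -> J' -> hdual) : matrix_rep X -> matrix_rep Y ->
  matrix_rep (fun i j : J' * J => X i.2 j.2 * Y i.1 j.1).
Proof.
move=> [X1 XM] [Y1 YM]; split=> [[i i'] [j j']|i j x y].
  by rewrite hmul1E X1 Y1 xpair_eqE /= andbC -mulnb natrM.
rewrite (hmulM (XM _ _) (YM _ _)) exchange_big.
exact: (pair_bigA _ (fun l k => (X i.2 k * Y i.1 l) x * (X k j.2 * Y l j.1) y)).
Qed.

Lemma matrix_rep_unit : matrix_rep (fun _ _ : unit => 1).
Proof.
split=> [[] []|_ _ x y]; first exact: counit1.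
rewrite (big_pred1 tt) => [|[] //]; exact: counitM.
Qed.

(** The transpose compensates for the reversal of products by kappa, as in a contragredient
    representation. *)
Lemma matrix_rep_antipode (J : finType) (X : J -> J -> hdual) :
  matrix_rep X -> matrix_rep (fun i j => dual_antipode (X j i)).
Proof.
move=> [X1 XM]; split=> [i j|i j x y].
  by rewrite -[LHS]/(X j i (antipode 1)) antipode1 X1 eq_sym.
rewrite -[LHS]/(X j i (antipode (x * y))) antipodeM XM.
by apply: eq_bigr => k _; apply: mulrC.
Qed.

(** * Transfer of the relations of T through a duality of [L] and [L'] *)

Section DualPair.
Variables L L' : I -> I -> hdual.
Hypotheses (HL : matrix_rep L) (HL' : matrix_rep L').
Hypothesis LL' : forall A C G H, L A C (T G H) = L' G H (antipode (T A C)).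

Lemma dual_pair_mul A B C D G H : (L A C * L B D) (T G H) =
  L' G H (antipode (T B D * T A C)).
Proof.
by rewrite hmulT antipodeM HL'.2; apply: eq_bigr => F _; rewrite !LL'.
Qed.

(** Quadratic relations among the T can be applied inside the right-hand side, and so become
    relations for [L] on generators. *)
Lemma dual_pair_sum (J : finType) (k : J -> K) (A B C D : J -> I) G H :
  \sum_j k j * (L (A j) (C j) * L (B j) (D j)) (T G H) =
  L' G H (antipode (\sum_j k j *: (T (B j) (D j) * T (A j) (C j)))).
Proof.
rewrite -[RHS]/(dual_antipode (L' G H) _) hlinear_sum.
by apply: eq_bigr => j _; rewrite dual_pair_mul.
Qed.

Lemma dual_pair_exchange : exchange_rel Rmat L L.
Proof.
move=> A B C D; rewrite !(pair_bigA _ (fun E F => _ *: _)) /=.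
apply: (@matrix_rep_intertwine _ _ (fun i j => Rmat i.1 i.2 j.1 j.2)
  (fun i j => L i.2 j.2 * L i.1 j.1) (fun i j => L i.1 j.1 * L i.2 j.2)
  _ _ _ (A, B) (C, D)); [exact: matrix_rep_mul'|exact: matrix_rep_mul|].
by move=> G H i l; rewrite !dual_pair_sum RTT'.
Qed.

Lemma dual_pair_metric : metric_rel L.
Proof.
have L2 := matrix_rep_mul' HL HL; have U := matrix_rep_unit.
have HL'' := matrix_rep_antipode HL'.
split=> [C D|C D]; rewrite !(pair_bigA _ (fun E F => _ *: _)) /=.
  have := matrix_rep_intertwine (M := fun i _ => Cup i.1 i.2) U L2.
  move=> /(_ _ (D, C) tt) <- => [|A B [i i'] _].
    by rewrite (big_pred1 tt) // => -[].
  rewrite dual_pair_sum CTT_up' (big_pred1 tt) => [|[] //].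
  rewrite -[RHS]/(dual_antipode (L' A B) _) hlinearZ HL''.1 eq_sym.
  by congr (_ * _); apply: counitT.
have := matrix_rep_intertwine (M := fun _ j => Clo j.1 j.2) L2 U.
move=> /(_ _ tt (D, C)) -> => [|A B _ [i i']].
  by rewrite (big_pred1 tt) // => -[].
rewrite dual_pair_sum CTT_lo' (big_pred1 tt) => [|[] //].
rewrite -[LHS]/(dual_antipode (L' A B) _) hlinearZ HL''.1 eq_sym.
by congr (_ * _); apply: esym (counitT _ _ _).
Qed.

End DualPair.

Lemma matrix_rep_comul (J : finType) (X : J -> J -> hdual) : matrix_rep X ->
  forall i j, dual_comul (X i j) = \sum_k htens (X i k) (X k j).
Proof.
move=> [_ XM] i j; apply: tensor_functionalP => x y.
rewrite functional_sum -[LHS]/(dual_comul (X i j) (tpure x y)) dual_comul_pure.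
by rewrite XM; apply: eq_bigr => k _; rewrite htens_pure.
Qed.

(** With [Cup] moved to the other side, the formula for kappa exhibits the metric as an intertwiner,
    the form needed in [dual_pair_antipode]. *)
Lemma Clo_antipode B D :
  \sum_C Clo B C *: antipode (T C D) = \sum_A Clo A D *: T A B.
Proof.
transitivity (\sum_F (F == B)%:R *: \sum_A Clo A D *: T A F).
  under eq_bigr => C _ do rewrite antipodeT scaler_sumr.
  rewrite exchange_big; apply: eq_bigr => F _.
  rewrite eq_sym -(Clo_Cup p) scaler_suml; apply: eq_bigr => C _.
  rewrite -scalerA; congr (_ *: _); rewrite scaler_sumr; apply: eq_bigr => A _.
  by rewrite scalerA.
exact: (sum_delta (fun F => \sum_A Clo A D *: T A F)).
Qed.

(** The metric intertwines [L] with its contragredient: on generators one duality leads to [L'],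
    where [Clo_antipode] applies, and the other leads back. Inverting the metric gives the
    formula. *)
Lemma dual_pair_antipode (L L' : I -> I -> hdual) :
  matrix_rep L ->
  (forall A C G H, L A C (T G H) = L' G H (antipode (T A C))) ->
  (forall A C G H, L' A C (T G H) = L G H (antipode (T A C))) ->
  forall A B, dual_antipode (L A B) =
    \sum_C \sum_D (Cup D A * Clo B C) *: L C D.
Proof.
move=> HL LL' L'L A B.
have h i l : \sum_C Clo i C *: L C l = \sum_C Clo C l *: dual_antipode (L C i).
  apply: (matrix_rep_intertwine HL (matrix_rep_antipode HL)) => E F {}i {}l.
  transitivity (L' E F (antipode (\sum_C Clo i C *: T C l))).
    rewrite -[RHS]/(dual_antipode (L' E F) _) hlinear_sum.
    by apply: eq_bigr => C _; rewrite LL'.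
  rewrite linear_sum; under eq_bigr => C _ do rewrite linearZ.
  rewrite Clo_antipode hlinear_sum; apply: eq_bigr => C _.
  by rewrite L'L.
rewrite exchange_big; under [RHS]eq_bigr => D _.
  under eq_bigr => C _ do rewrite -scalerA.
  rewrite -scaler_sumr h scaler_sumr; under eq_bigr => C _ do rewrite scalerA.
  over.
rewrite exchange_big -[LHS](sum_delta (fun C => dual_antipode (L C B))).
apply: eq_bigr => C _; rewrite -scaler_suml -(Clo_Cup p).
by congr (_ *: _); apply: eq_bigr => D _; rewrite mulrC.
Qed.

Lemma matrix_rep_costructure (L L' : I -> I -> hdual) :
  matrix_rep L ->
  (forall A C G H, L A C (T G H) = L' G H (antipode (T A C))) ->
  (forall A C G H, L' A C (T G H) = L G H (antipode (T A C))) ->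
  costructure_rel L.
Proof.
move=> HL LL' L'L; split; first exact: matrix_rep_comul.
  exact: HL.1.
exact: dual_pair_antipode LL' L'L.
Qed.

(** [L A B] is evaluated on T^C_E kappa(T^E_D) = delta. Hence the values of [L] on T form an
    invertible matrix, inverted by the values on kappa(T). *)
Lemma matrix_repTV (L : I -> I -> hdual) : matrix_rep L -> forall A B C D,
  \sum_(x : I * I) L A x.2 (T C x.1) * L x.2 B (antipode (T x.1 D)) =
  ((A, C) == (B, D))%:R.
Proof.
move=> HL A B C D.
rewrite -(pair_bigA _ (fun E F => L A F (T C E) * L F B (antipode (T E D)))).
transitivity (\sum_E L A B (T C E * antipode (T E D))).
  by apply: eq_bigr => E _; rewrite HL.2.
rewrite -linear_sum; under eq_bigr => E _ do rewrite antipode_TE.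
rewrite antipode_genr xpair_eqE; case: (C == D); last first.
  by rewrite andbF [LHS]linear0.
by rewrite andbT [LHS]HL.1.
Qed.

(** * Invertibility of R and the duality of L^+ and L^- *)

Definition pair_mx (f : I * I -> I * I -> K) : 'M[K]_#|{: I * I}| :=
  \matrix_(i, j) f (enum_val i) (enum_val j).

Lemma pair_mx_mul1 (f g : I * I -> I * I -> K) :
  (forall i j, \sum_k f i k * g k j = (i == j)%:R) ->
  pair_mx f *m pair_mx g = 1%:M.
Proof.
move=> h; apply/matrixP => i j; rewrite !mxE -(inj_eq enum_val_inj) -h.
rewrite (reindex _ (onW_bij _ (@enum_rank_bij (I * I)%type))).
by apply: eq_bigr => k _; rewrite !mxE enum_rankK.
Qed.

Section Lpm.
Variables Lplus Lminus : I -> I -> hdual.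
Hypotheses (HLplus : is_Lplus Lplus) (HLminus : is_Lminus Lminus).

Lemma Lplus_rep : matrix_rep Lplus. Proof. by case: HLplus. Qed.
Lemma Lminus_rep : matrix_rep Lminus. Proof. by case: HLminus. Qed.
Lemma LplusT A B C D : Lplus A B (T C D) = Rmat C A D B.
Proof. by case: HLplus. Qed.
Lemma LminusT A B C D : Lminus A B (T C D) = Rinv A C B D.
Proof. by case: HLminus. Qed.

(** R collects the values of L^+ on T, so [matrix_repTV] supplies its inverse. Invertibility of R
    thus comes from the existence of L^+; it matters because [invmx] returns a singular matrix
    unchanged. *)
Lemma Rsquare_rinv : Rsquare p *m
  pair_mx (fun i j => Lplus i.2 j.2 (antipode (T i.1 j.1))) = 1%:M.
Proof.
have -> : Rsquare p = pair_mx (fun i j => Rmat i.1 i.2 j.1 j.2).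
  by apply/matrixP => i j; rewrite !mxE.
apply: pair_mx_mul1 => [[A B] [C D]].
rewrite !xpair_eqE andbC -xpair_eqE -(matrix_repTV Lplus_rep).
by apply: eq_bigr => x _; rewrite LplusT.
Qed.

Lemma Rsquare_unit : Rsquare p \in unitmx.
Proof. by case/mulmx1_unit: Rsquare_rinv. Qed.

(** Both sides are entries of R^{-1}, by uniqueness of the inverse. *)
Lemma Lminus_dual A C G H : Lminus A C (T G H) = Lplus G H (antipode (T A C)).
Proof.
have := congr1 (mulmx (invmx (Rsquare p))) Rsquare_rinv.
rewrite mulKmx ?Rsquare_unit // mulmx1 => h.
by rewrite LminusT /Rinv -h !mxE !enum_rankK.
Qed.

Lemma Lplus_dual A C G H : Lplus A C (T G H) = Lminus G H (antipode (T A C)).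
Proof.
have : pair_mx (fun i j => Rinv i.1 i.2 j.1 j.2) *m
  pair_mx (fun i j => Lminus i.1 j.1 (antipode (T i.2 j.2))) = 1%:M.
  apply: pair_mx_mul1 => [[B D] [E F]]; rewrite -(matrix_repTV Lminus_rep).
  (* [Rinv] lists the indices of the functional before those of T, opposite to [Rmat] in [LplusT];
     hence the swap. *)
  rewrite (reindex (fun z : I * I => (z.2, z.1))) /=; last first.
    by exists (fun z : I * I => (z.2, z.1)) => -[].
  by apply: eq_bigr => z _; rewrite LminusT.
have -> : pair_mx (fun i j => Rinv i.1 i.2 j.1 j.2) = invmx (Rsquare p).
  apply/matrixP => i j; rewrite !mxE /Rinv.
  by rewrite -!surjective_pairing !enum_valK.
move=> /(congr1 (mulmx (Rsquare p))); rewrite mulKVmx ?Rsquare_unit // mulmx1.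
move=> /matrixP /(_ (enum_rank (G, A)) (enum_rank (H, C))).
by rewrite !mxE !enum_rankK LplusT => <-.
Qed.

Lemma Rmat_Rinv (i j : I * I) :
  \sum_k Rmat i.1 i.2 k.1 k.2 * Rinv k.1 k.2 j.1 j.2 = (i == j)%:R.
Proof.
have /matrixP/(_ (enum_rank i) (enum_rank j)) := mulmxV Rsquare_unit.
rewrite !mxE (inj_eq enum_rank_inj) => <-.
rewrite [RHS](reindex _ (onW_bij _ (@enum_rank_bij (I * I)%type))).
by apply: eq_bigr => k _; rewrite !mxE !enum_rankK /Rinv -!surjective_pairing.
Qed.

Lemma Rinv_Rmat (i j : I * I) :
  \sum_k Rinv i.1 i.2 k.1 k.2 * Rmat k.1 k.2 j.1 j.2 = (i == j)%:R.
Proof.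
have /matrixP/(_ (enum_rank i) (enum_rank j)) := mulVmx Rsquare_unit.
rewrite !mxE (inj_eq enum_rank_inj) => <-.
rewrite [RHS](reindex _ (onW_bij _ (@enum_rank_bij (I * I)%type))).
by apply: eq_bigr => k _; rewrite !mxE !enum_rankK /Rinv -!surjective_pairing.
Qed.

End Lpm.

(** Multiply k X = X' k by the inverse [ki] on both sides. *)
Lemma intertwine_inv (J : finType) (V : lmodType K) (k ki : J -> J -> K)
    (X X' : J -> J -> V) :
  (forall i j, \sum_m k i m * ki m j = (i == j)%:R) ->
  (forall i j, \sum_m ki i m * k m j = (i == j)%:R) ->
  (forall i j, \sum_m k i m *: X m j = \sum_m k m j *: X' i m) ->
  forall i j, \sum_m ki m j *: X i m = \sum_m ki i m *: X' m j.
Proof.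
move=> kki kik h i j.
have dl (F : J -> V) m : \sum_n (m == n)%:R *: F n = F m.
  rewrite (bigD1 m) //= eqxx scale1r big1 ?addr0 // => n.
  by rewrite eq_sym => /negPf ->; rewrite scale0r.
have eX m : X i m = \sum_n ki i n *: \sum_l k l m *: X' n l.
  under eq_bigr => n _ do rewrite -h scaler_sumr.
  rewrite exchange_big -[LHS](dl (X^~ m)); apply: eq_bigr => l _.
  by rewrite -kik scaler_suml; apply: eq_bigr => n _; rewrite scalerA.
under eq_bigr => m _ do rewrite eX scaler_sumr.
rewrite exchange_big; apply: eq_bigr => n _.
transitivity (ki i n *: \sum_m \sum_l (k l m * ki m j) *: X' n l).
  rewrite scaler_sumr; apply: eq_bigr => m _.
  rewrite scalerA mulrC -scalerA scaler_sumr; congr (_ *: _).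
  by apply: eq_bigr => l _; rewrite scalerA mulrC.
rewrite exchange_big -[X' n j](dl (X' n)); congr (_ *: _).
by apply: eq_bigr => l _; rewrite -scaler_suml kki eq_sym.
Qed.

(** * Weights and the block-diagonal part of L^+ *)

Section Weights.

(* The weight of an index under the torus that acts on the first and the last
   basis vector only, shifted to 0, 1, 2: both R and the metric preserve it. *)
Definition wt (A : I) : nat :=
  if A == ord0 then 0%N else if A == ord_max then 2%N else 1%N.

Lemma wt_rev A : (wt (rev_ord A) + wt A = 2)%N.
Proof.
case: A => a ha; rewrite /wt -!val_eqE /=; do !case: eqP => ? /=; lia.
Qed.

Lemma leq_wt (A B : I) : (A <= B)%N -> (wt A <= wt B)%N.
Proof.
case: A B => [a ha] [b hb]; rewrite /wt -!val_eqE /= => h; do !case: eqP => ? /=; lia.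
Qed.

Lemma innerE (A : I) : inner A = (wt A == 1)%N.
Proof. by case: A => a ha; rewrite /inner /wt -!val_eqE /=; do !case: eqP => ? /=; lia. Qed.

(** The fibres of [wt] are circ, the inner indices and bullet, so equality of weights is the block
    pattern of [block_diag]. *)
Lemma eq_wt (A B : I) : (wt A == wt B) = (A == B) || inner A && inner B.
Proof.
case: A B => [a ha] [b hb]; rewrite /inner /wt -!val_eqE /=.
by have [] := (a =P 0%N, a =P N.+1); have [] := (b =P 0%N, b =P N.+1);
  do 4!case=> ? /=; lia.
Qed.

(** The inequality yields the triangularity of L^+; each of the three index patterns conserves the
    total weight. *)
Lemma Rmat_support A B C D : Rmat A B C D != 0 ->
  (B <= D)%N /\
  [\/ C = A /\ D = B, C = B /\ D = A | B = rev_ord A /\ D = rev_ord C].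
Proof.
rewrite /Defs.Rmat.
case: ifP => [/and3P[/eqP -> /eqP -> /eqP ->] _|_].
  by split=> //; constructor 1.
case: ifP => [/and3P[/eqP -> /eqP -> /eqP ->] _|_].
  by split=> //; constructor 1.
case: ifP => [/andP[/eqP -> /eqP ->] _|_].
  by split=> //; constructor 1.
case: ifP => [/and3P[/eqP -> /eqP -> _]|_].
  by case: ifP => [/ltnW BA _|_ /eqP //]; split=> //; constructor 2.
case: ifP => [/and3P[/eqP -> /eqP -> _]|_].
  by case: ifP => [/ltnW BA _|_ /eqP //]; split=> //; constructor 2.
case: ifP => [/andP[/eqP -> /eqP ->]|_ /eqP //].
case: ifP => [CA _|_ /eqP //]; split; last by constructor 3.
by move: CA; case: A C => [a ha] [c hc] /=; lia.
Qed.

Lemma Rmat_wt A B C D : Rmat A B C D != 0 -> (wt A + wt B = wt C + wt D)%N.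
Proof.
case/Rmat_support => _ [[-> ->]|[-> ->]|[-> ->]] //; first by rewrite addnC.
by rewrite ![(wt _ + wt (rev_ord _))%N]addnC !wt_rev.
Qed.

(** On each index pattern in the support of R, equal weights in the second slot make the entry
    either diagonal or entirely inner. *)
Lemma calR_wt A B C D :
  calR p A B C D = if wt B == wt D then Rmat A B C D else 0.
Proof.
rewrite /calR; have [->|] := eqVneq (Rmat A B C D) 0; first by do 2 case: ifP.
move=> /Rmat_support[_ supp]; congr (if _ then _ else 0); rewrite !innerE.
have wA := wt_rev A; have wC := wt_rev C.
have [wBD|] := eqVneq (wt B) (wt D); last first.
  by apply: contra_neqF => /orP[/and4P[_ /eqP -> _ /eqP ->]|/andP[_ /eqP ->]].
have hBD := eq_wt B D; move: hBD; rewrite wBD eqxx !innerE => /esym hBD.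
case: supp hBD => [[-> ->]|[-> ->]|[eB eD]]; first by rewrite !eqxx orbT.
  case/orP=> [/eqP ->|/andP[-> ->] //]; by rewrite !eqxx orbT.
case/orP=> [/eqP eBD|/andP[hB hD]].
  by rewrite eBD eqxx andbT -(inj_eq rev_ord_inj) -eB -eD eBD eqxx orbT.
move: wA wC; rewrite -eB -eD (eqP hB) (eqP hD) !add1n => -[->] [->].
by rewrite !eqxx.
Qed.

Lemma Clo_support A B : Clo A B != 0 -> A = rev_ord B.
Proof.
by rewrite /Defs.Clo mxE; case: (A =P rev_ord B) => // _; rewrite mulr0n eqxx.
Qed.

(** A nonzero entry off the antidiagonal would force [Clo B (rev_ord B)], the only entry of its row
    that can be nonzero, to vanish, against [Clo_Cup]. *)
Lemma Cup_support A B : Cup A B != 0 -> A = rev_ord B.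
Proof.
move=> CAB; have := Cup_Clo p A (rev_ord B); rewrite (bigD1 B) //=.
rewrite big1 ?addr0 => [|C CB]; last first.
  have [->|/Clo_support eC] := eqVneq (Clo C (rev_ord B)) 0.
    by rewrite mulr0.
  by rewrite eC rev_ordK eqxx in CB.
case: eqP => // _ /eqP; rewrite mulf_eq0 (negPf CAB) /= => /eqP CB0.
have := Clo_Cup p B B; rewrite eqxx (bigD1 (rev_ord B)) //= CB0 mul0r add0r.
rewrite big1 => [/eqP|C CB]; first by rewrite eq_sym oner_eq0.
have [->|/Clo_support eC] := eqVneq (Clo B C) 0; first by rewrite mul0r.
by rewrite eC rev_ordK eqxx in CB.
Qed.

Lemma Clo_wt A B : Clo A B != 0 -> (wt A + wt B = 2)%N.
Proof. by move/Clo_support ->; apply: wt_rev. Qed.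

Lemma Cup_wt A B : Cup A B != 0 -> (wt A + wt B = 2)%N.
Proof. by move/Cup_support ->; apply: wt_rev. Qed.

Lemma block_diag_wt (L : I -> I -> hdual) A B :
  block_diag L A B = if wt A == wt B then L A B else 0.
Proof. by rewrite /block_diag eq_wt. Qed.

Variable L : I -> I -> hdual.
Hypothesis L_wt : forall A B, (wt B < wt A)%N -> L A B = 0.
Local Notation calL := (block_diag L).

(** No factor lowers the weight, so the total is kept only if both factors keep it. The truncation
    thus depends on totals alone, which R and the metric conserve. *)
Lemma block_diag_mul A B C D : calL A B * calL C D =
  if wt A + wt C == wt B + wt D then L A B * L C D else 0.
Proof.
rewrite !block_diag_wt.
have [lAB|gAB|eAB] := ltngtP (wt A) (wt B).
- rewrite /= mul0r; case: eqP => // eAC.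
  by rewrite (@L_wt C D) ?mulr0 //; lia.
- by rewrite /= (@L_wt A B) // !mul0r if_same.
- by rewrite eAB eqn_add2l; case: ifP => _ //; rewrite mulr0.
Qed.

(** Block-triangular matrices multiply blockwise on the diagonal. *)
Lemma block_diag_rep : matrix_rep L -> matrix_rep calL.
Proof.
move=> [L1 LM]; split=> [A B|A B x y]; rewrite block_diag_wt.
  case: eqP => [_|wAB]; first exact: L1.
  by case: eqP => // AB; rewrite AB in wAB.
case: eqP => [eAB|nAB]; last first.
  rewrite big1 // => C _; rewrite !block_diag_wt.
  case: eqP => [eAC|_]; last exact: mul0r.
  by case: eqP => [eCB|_]; [case: nAB; rewrite eAC|exact: mulr0].
rewrite LM; apply: eq_bigr => C _; rewrite !block_diag_wt eAB.
have [lBC|gBC|//] := ltngtP (wt B) (wt C).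
  by rewrite (@L_wt C B) //= !mulr0.
by rewrite (@L_wt A C) ?eAB //= !mul0r.
Qed.

Lemma block_diag_exchange : exchange_rel Rmat L L -> exchange_rel Rmat calL calL.
Proof.
(* If the outer weights balance, so do those of each product on the support of R, where [calL] can
   be replaced by [L]; otherwise all terms vanish. *)
move=> h A B C D; have [eW|/negPf nW] := eqVneq (wt A + wt B)%N (wt C + wt D)%N.
  rewrite -[LHS]/(\sum_E \sum_F Rmat A B E F *: (calL F D * calL E C)).
  transitivity (\sum_E \sum_F Rmat A B E F *: (L F D * L E C)).
    apply: eq_bigr => E _; apply: eq_bigr => F _.
    have [->|/Rmat_wt wR] := eqVneq (Rmat A B E F) 0; first by rewrite !scale0r.
    by rewrite block_diag_mul; case: eqP => // -[]; lia.
  rewrite h; apply: eq_bigr => E _; apply: eq_bigr => F _.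
  have [->|/Rmat_wt wR] := eqVneq (Rmat E F C D) 0; first by rewrite !scale0r.
  by rewrite block_diag_mul; case: eqP => // -[]; lia.
transitivity (0 : hdual).
  apply: big1 => E _; apply: big1 => F _.
  have [->|/Rmat_wt wR] := eqVneq (Rmat A B E F) 0; first by rewrite !scale0r.
  by rewrite block_diag_mul; case: eqP => [|_]; [lia|rewrite scaler0].
symmetry; apply: big1 => E _; apply: big1 => F _.
have [->|/Rmat_wt wR] := eqVneq (Rmat E F C D) 0; first by rewrite !scale0r.
by rewrite block_diag_mul; case: eqP => [|_]; [lia|rewrite scaler0].
Qed.

Lemma block_diag_mul_neq0 A B C D : calL A B * calL C D != 0 ->
  wt A = wt B /\ wt C = wt D.
Proof.
move=> h; split; apply/eqP; apply: contraNT h => /negPf w.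
  by rewrite (block_diag_wt L A) w mul0r.
by rewrite (block_diag_wt L C) w mulr0.
Qed.

(** Entries of [calL] keep the weight in each slot. If A, C and B, D have equal weights, [calR]
    agrees with R wherever the products are nonzero; otherwise every term vanishes. *)
Lemma block_diag_exchange_calR :
  exchange_rel Rmat calL calL -> exchange_rel (calR p) calL calL.
Proof.
move=> h A B C D.
have [/andP[/eqP wAC /eqP wBD]|wn] := boolP ((wt A == wt C) && (wt B == wt D)).
  transitivity (\sum_E \sum_F Rmat A B E F *: (calL F D * calL E C)).
    apply: eq_bigr => E _; apply: eq_bigr => F _; rewrite calR_wt wBD.
    have [->|/block_diag_mul_neq0[-> _]] := eqVneq (calL F D * calL E C) 0.
      by rewrite !scaler0.
    by rewrite eqxx.
  rewrite h; apply: eq_bigr => E _; apply: eq_bigr => F _; rewrite calR_wt -wBD.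
  have [->|/block_diag_mul_neq0[_ <-]] := eqVneq (calL A E * calL B F) 0.
    by rewrite !scaler0.
  by rewrite eqxx.
transitivity (0 : hdual).
  apply: big1 => E _; apply: big1 => F _.
  rewrite calR_wt; case: eqP => [wBF|_]; last exact: scale0r.
  have [->|/Rmat_wt wR] := eqVneq (Rmat A B E F) 0; first by rewrite !scale0r.
  have [->|/block_diag_mul_neq0[w1 w2]] := eqVneq (calL F D * calL E C) 0.
    exact: scaler0.
  by case/negP: wn; apply/andP; split; apply/eqP; lia.
symmetry; apply: big1 => E _; apply: big1 => F _.
rewrite calR_wt; case: eqP => [wBF|_]; last exact: scale0r.
have [->|/Rmat_wt wR] := eqVneq (Rmat E F C D) 0; first by rewrite !scale0r.
have [->|/block_diag_mul_neq0[w1 w2]] := eqVneq (calL A E * calL B F) 0.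
  exact: scaler0.
by case/negP: wn; apply/andP; split; apply/eqP; lia.
Qed.

Lemma block_diag_metric : metric_rel L -> metric_rel calL.
Proof.
move=> [hup hlo]; split=> C D.
  have [eW|nW] := eqVneq (wt D + wt C)%N 2%N.
    rewrite -hup; apply: eq_bigr => A _; apply: eq_bigr => B _.
    have [->|/Cup_wt wC] := eqVneq (Cup A B) 0; first by rewrite !scale0r.
    by rewrite block_diag_mul; case: eqP => // -[]; lia.
  have -> : Cup D C = 0 by apply: contra_neq_eq nW => /Cup_wt.
  rewrite scale0r; apply: big1 => A _; apply: big1 => B _.
  have [->|/Cup_wt wC] := eqVneq (Cup A B) 0; first by rewrite !scale0r.
  by rewrite block_diag_mul; case: eqP => [|_]; [lia|rewrite scaler0].
have [eW|nW] := eqVneq (wt D + wt C)%N 2%N.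
  rewrite -hlo; apply: eq_bigr => A _; apply: eq_bigr => B _.
  have [->|/Clo_wt wC] := eqVneq (Clo A B) 0; first by rewrite !scale0r.
  by rewrite block_diag_mul; case: eqP => // -[]; lia.
have -> : Clo D C = 0 by apply: contra_neq_eq nW => /Clo_wt.
rewrite scale0r; apply: big1 => A _; apply: big1 => B _.
have [->|/Clo_wt wC] := eqVneq (Clo A B) 0; first by rewrite !scale0r.
by rewrite block_diag_mul; case: eqP => [|_]; [lia|rewrite scaler0].
Qed.

(** Contraction with the metric exchanges the weights w and 2 - w, so A and B have equal weights
    exactly when the contributing C and D do. *)
Lemma block_diag_costructure :
  matrix_rep L -> costructure_rel L -> costructure_rel calL.
Proof.
move=> HL [_ _ hS]; have HcL := block_diag_rep HL; split.
- exact: matrix_rep_comul.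
- exact: HcL.1.
move=> A B; rewrite block_diag_wt.
transitivity (if wt A == wt B then dual_antipode (L A B) else 0).
  by case: ifP => // _; apply: functionalP.
rewrite hS; case: ifP => wAB; last first.
  symmetry; apply: big1 => C _; apply: big1 => D _.
  have [->|/Cup_wt w1] := eqVneq (Cup D A) 0; first by rewrite mul0r scale0r.
  have [->|/Clo_wt w2] := eqVneq (Clo B C) 0; first by rewrite mulr0 scale0r.
  by rewrite block_diag_wt; case: eqP => [|_]; [lia|rewrite scaler0].
apply: eq_bigr => C _; apply: eq_bigr => D _.
have [->|/Cup_wt w1] := eqVneq (Cup D A) 0; first by rewrite mul0r !scale0r.
have [->|/Clo_wt w2] := eqVneq (Clo B C) 0; first by rewrite mulr0 !scale0r.
by rewrite block_diag_wt; case: eqP => [//|[]]; lia.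
Qed.
End Weights.

(* On T^G_H, since calR^{AB}_{EF} = calL^B_F(T^A_E), each side is calL^B_D applied
   to one side of the RTT relation multiplied by R^{-1} on both ends. *)
Lemma calR_exchange (calL Lplus Lminus : I -> I -> hdual) :
  is_Lplus Lplus -> is_Lminus Lminus -> matrix_rep calL ->
  (forall A B C D, calR p A B C D = calL B D (T A C)) ->
  exchange_rel (calR p) calL Lminus.
Proof.
move=> HLplus HLminus HcL hR.
have HLm := Lminus_rep HLminus.
move=> A B C D; rewrite !(pair_bigA _ (fun E F => _ *: _)) /=.
apply: (@matrix_rep_intertwine _ _ (fun i j => calR p i.1 i.2 j.1 j.2)
  (fun i j => calL i.2 j.2 * Lminus i.1 j.1)
  (fun i j => Lminus i.1 j.1 * calL i.2 j.2) _ _ _ (A, B) (C, D));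
  [exact: matrix_rep_mul'|exact: matrix_rep_mul|].
move=> G H {A B C D} [A B] [C D].
rewrite -(pair_bigA _
  (fun E F => calR p A B E F * (calL F D * Lminus E C) (T G H))).
rewrite -(pair_bigA _
  (fun E F => calR p E F C D * (Lminus A E * calL B F) (T G H))).
transitivity (calL B D (\sum_(x : I * I) Rinv x.1 x.2 C H *:
    (T A x.1 * T G x.2))).
  rewrite hlinear_sum.
  rewrite -(pair_bigA _ (fun E K => Rinv E K C H * calL B D (T A E * T G K))).
  apply: eq_bigr => E _.
  under eq_bigr => F _ do rewrite hmulT mulr_sumr.
  rewrite exchange_big; apply: eq_bigr => G' _.
  rewrite HcL.2 mulr_sumr; apply: eq_bigr => F _.
  by rewrite hR (LminusT HLminus) mulrA mulrC.
transitivity (calL B D (\sum_(x : I * I) Rinv A G x.1 x.2 *: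
    (T x.2 H * T x.1 C))).
  congr (calL B D _).
  apply: (@intertwine_inv _ _ (fun i j => Rmat i.1 i.2 j.1 j.2)
    (fun i j => Rinv i.1 i.2 j.1 j.2)
    (fun i j => T i.1 j.1 * T i.2 j.2) (fun i j => T i.2 j.2 * T i.1 j.1)
    _ _ _ (A, G) (C, H)).
  - exact: Rmat_Rinv HLplus.
  - exact: Rinv_Rmat HLplus.
  - by move=> i j; apply: RTT'.
rewrite hlinear_sum.
rewrite -(pair_bigA _ (fun E K => Rinv A G E K * calL B D (T K H * T E C))).
apply: eq_bigr => E _.
under [RHS]eq_bigr => F _ do rewrite hmulT mulr_sumr.
rewrite [RHS]exchange_big; apply: eq_bigr => G' _.
rewrite HcL.2 mulr_sumr; apply: eq_bigr => F _.
by rewrite hR (LminusT HLminus) mulrA [RHS]mulrC.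
Qed.

(** R^{CA}_{DB} vanishes for A > B, and triangularity survives matrix products: a middle index E has
    weight either below that of A or above that of B. *)
Lemma Lplus_wt (Lplus : I -> I -> hdual) : is_Lplus Lplus ->
  forall A B, (wt B < wt A)%N -> Lplus A B = 0.
Proof.
move=> HL A B wBA; apply: functionalP => x; rewrite functional_zero.
elim/qgroup_ind: x B wBA => [|k x y hx hy|x C D hx] B wBA.
- rewrite (Lplus_rep HL).1; case: eqP => // eAB.
  by rewrite eAB ltnn in wBA.
- by rewrite hlinearP hx // hy // mulr0 addr0.
- rewrite (Lplus_rep HL).2 big1 // => E _; rewrite (LplusT HL).
  have [wEA|wAE] := ltnP (wt E) (wt A); first by rewrite hx // mul0r.
  have [->|/Rmat_support[/leq_wt wEB _]] := eqVneq (Rmat C E D B) 0.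
    exact: mulr0.
  by lia.
Qed.

(** * Hopf algebras generated by functionals *)

Section HopfSubalgebra.
Variable G : hdual -> Prop.

Lemma subalg_gen_lin k phi psi :
  subalg_gen G phi -> subalg_gen G psi -> subalg_gen G (k *: phi + psi).
Proof. by move=> hphi hpsi; apply/subalg_D/hpsi/subalg_Z. Qed.

Lemma subalg_gen0 : subalg_gen G 0.
Proof. by rewrite -(scale0r 1); apply/subalg_Z/subalg_1. Qed.

Lemma subalg_gen_sum (J : finType) (f : J -> hdual) :
  (forall j, subalg_gen G (f j)) -> subalg_gen G (\sum_j f j).
Proof.
move=> hf; elim/big_rec: _ => [|j phi _ hphi]; first exact: subalg_gen0.
exact: subalg_D.
Qed.

(** Delta' is tested on products, and the index type is arbitrary, so that sums and products of
    functionals use sums and products of index types. *)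
Definition splits phi := exists (J : finType) (phi1 phi2 : J -> hdual),
  (forall j, subalg_gen G (phi1 j) /\ subalg_gen G (phi2 j)) /\
  forall x y, phi (x * y) = \sum_j phi1 j x * phi2 j y.

Lemma splits1 : splits 1.
Proof.
exists unit, (fun=> 1), (fun=> 1); split=> [_|x y].
  by split; apply: subalg_1.
by rewrite (big_pred1 tt) => [|[] //]; apply: counitM.
Qed.

Lemma subalg_gen_splits :
  (forall phi, G phi -> splits phi) ->
  forall phi, subalg_gen G phi -> splits phi.
Proof.
move=> hG phi; elim=> {phi} [phi|||k phi _|].
- exact: hG.
- exact: splits1.
- move=> phi psi _ [J [phi1 [phi2 [h12 hphi]]]] _ [J' [psi1 [psi2 [h12' hpsi]]]].
  exists (J + J')%type, (fun j => match j with inl j => phi1 j | inr j => psi1 j end),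
    (fun j => match j with inl j => phi2 j | inr j => psi2 j end).
  split=> [[]//|x y]; rewrite functional_add hphi hpsi.
  by rewrite [RHS]big_sumType.
- move=> [J [phi1 [phi2 [h12 hphi]]]].
  exists J, (fun j => k *: phi1 j), phi2; split=> [j|x y].
    by split; [apply: subalg_Z; case: (h12 j)|case: (h12 j)].
  rewrite functional_scale hphi mulr_sumr; apply: eq_bigr => j _.
  by rewrite functional_scale -[RHS]mulrA.
- move=> phi psi _ [J [phi1 [phi2 [h12 hphi]]]] _ [J' [psi1 [psi2 [h12' hpsi]]]].
  exists (J * J')%type, (fun j => phi1 j.1 * psi1 j.2),
    (fun j => phi2 j.1 * psi2 j.2); split=> [j|x y].
    by have [? ?] := h12 j.1; have [? ?] := h12' j.2; split; apply: subalg_M.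
  rewrite (hmulM hphi hpsi).
  exact: (pair_bigA _ (fun i j => (phi1 i * psi1 j) x * (phi2 i * psi2 j) y)).
Qed.

Lemma splits_comul phi : splits phi ->
  exists n (phi1 phi2 : 'I_n -> hdual),
    (forall i, subalg_gen G (phi1 i) /\ subalg_gen G (phi2 i)) /\
    dual_comul phi = \sum_i htens (phi1 i) (phi2 i).
Proof.
move=> [J [phi1 [phi2 [h12 hphi]]]].
exists #|J|, (fun i => phi1 (enum_val i)), (fun i => phi2 (enum_val i)).
split=> [i|]; first exact: h12.
apply: tensor_functionalP => x y; rewrite functional_sum.
rewrite -[LHS]/(dual_comul phi (tpure x y)) dual_comul_pure hphi.
rewrite [RHS](reindex _ (onW_bij _ (@enum_rank_bij J))).
by apply: eq_bigr => j _; rewrite enum_rankK htens_pure.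
Qed.

Lemma dual_antipode1 : dual_antipode 1 = 1 :> hdual.
Proof.
apply: functionalP => x; rewrite -[LHS]/(counit (antipode x)).
rewrite -[RHS]/(counit x).
elim/qgroup_ind: x => [|k x y hx hy|x A B hx].
- by rewrite antipode1.
- by rewrite linearP !(hlinearP (@dual_unit K S N p)) /dual_unit /= hx hy.
- rewrite antipodeM !counitM hx mulrC; congr (_ * _).
  (* Applying the counit to kappa(T^A_C) T^C_B = delta isolates kappa(T^A_B), because the counit of
     T is delta. *)
  have sumE := linear_sum (@counit K S N p) (index_enum I) xpredT
    (fun C => antipode_gen p A C * T C B).
  rewrite antipode_genl [LHS]rmorph_nat in sumE.
  rewrite counitT sumE antipode_TE -[LHS](sum_delta (fun C =>
    counit (antipode_gen p A C))); apply: eq_bigr => C _.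
  by rewrite [RHS]counitM counitT [RHS]mulrC.
Qed.

(** Generators suffice because Delta' is multiplicative and kappa' antimultiplicative. *)
Lemma hopf_subalg_gen :
  (forall phi, G phi -> splits phi) ->
  (forall phi, G phi -> subalg_gen G (dual_antipode phi)) ->
  hopf_functionals (subalg_gen G).
Proof.
move=> hD hS; split.
- by split; [apply: subalg_1|move=> *; apply: subalg_gen_lin].
- by move=> phi psi; apply: subalg_M.
- by move=> phi hphi; apply/splits_comul/subalg_gen_splits.
- move=> phi; elim=> {phi} [phi||phi psi _ h1 _ h2|k phi _ h|phi psi _ h1 _ h2].
  + exact: hS.
  + by rewrite dual_antipode1; apply: subalg_1.
  + have -> : dual_antipode (phi + psi) = dual_antipode phi + dual_antipode psi.
      exact: functionalP.
    exact: subalg_D.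
  + have -> : dual_antipode (k *: phi) = k *: dual_antipode phi.
      exact: functionalP.
    exact: subalg_Z.
  + by rewrite dual_antipodeM; apply: subalg_M.
Qed.
End HopfSubalgebra.
End Dual.

(** * Assembly of the relations and the Hopf structure of [IU] *)

Local Open Scope complex_scope.

Theorem theorem4p4p2 (F : realType) (S : series) (N : nat)
    (p : qparams F[i] S N)
    (Lplus Lminus : 'I_N.+2 -> 'I_N.+2 -> hdual p)
    (HLplus : is_Lplus Lplus) (HLminus : is_Lminus Lminus) :
  let calL := block_diag Lplus in
  let IU := IU_alg Lplus Lminus in
  [/\ hopf_functionals IU,
      forall phi, IU phi -> U_alg Lplus Lminus phi
    & forall phi, IU phi <->
        subalg_gen (fun psi => [\/ psi = dual_unit p,
                                   exists A B, psi = Lminus A B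
                                 | exists A B, psi = calL A B]) phi] /\
  [/\ exchange_rel (Rmat p) calL calL,
      exchange_rel (calR p) calL calL,
      exchange_rel (Rmat p) Lminus Lminus,
      exchange_rel (calR p) calL Lminus
    & forall A B C D, calR p A B C D = calL B D (T p A C)] /\
  (metric_rel calL /\ metric_rel Lminus) /\
  (costructure_rel calL /\ costructure_rel Lminus).
Proof.
move=> calL IU.
have [Rp Rm] := (Lplus_rep HLplus, Lminus_rep HLminus).
have dp := Lplus_dual HLplus HLminus; have dm := Lminus_dual HLplus HLminus.
have wp := Lplus_wt HLplus; have RcL : matrix_rep calL := block_diag_rep wp Rp.
have hR A B C D : calR p A B C D = calL B D (T p A C).
  rewrite calR_wt /calL block_diag_wt.
  by case: ifP => // _; rewrite (LplusT HLplus).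
have xL := block_diag_exchange wp (dual_pair_exchange Rp Rm dp).
have cL : costructure_rel calL.
  exact: block_diag_costructure wp Rp (matrix_rep_costructure Rp dp dm).
have cm := matrix_rep_costructure Rm dm dp.
pose G psi := [\/ psi = dual_unit p, exists A B, psi = Lminus A B
                | exists A B, psi = calL A B].
have IUE phi : IU phi <-> subalg_gen G phi.
  split; elim=> {phi} [phi|||k phi _ h|]; try exact: subalg_1.
  - case=> [->|[[A [B ->]]|[a [b [ha hb ->]]]|->|->]].
    + exact: subalg_1.
    + by apply: subalg_in; constructor 2; exists A, B.
    + apply: subalg_in; constructor 3; exists a, b.
      by rewrite /calL /block_diag ha hb orbT.
    + apply: subalg_in; constructor 3; exists ord0, ord0.
      by rewrite /calL /block_diag eqxx.
    + apply: subalg_in; constructor 3; exists ord_max, ord_max.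
      by rewrite /calL /block_diag eqxx.
  - by move=> *; apply: subalg_D.
  - exact: subalg_Z.
  - by move=> *; apply: subalg_M.
  - case=> [->|[A [B ->]]|[A [B ->]]].
    + exact: subalg_1.
    + by apply: subalg_in; right; constructor 1; exists A, B.
    (* Outside the blocks the entry is 0; inside them it is a generator of [IU], a non-inner
       diagonal one sitting at circ or bullet. *)
    + rewrite /calL /block_diag; case: ifP => [|_]; last exact: subalg_gen0.
      case/orP=> [/eqP <-|/andP[hA hB]]; last first.
        by apply: subalg_in; right; constructor 2; exists A, B.
      have [hA|] := boolP (inner A).
        by apply: subalg_in; right; constructor 2; exists A, A.
      rewrite negb_and !negbK => /orP[] /eqP ->; apply: subalg_in; right.
        by constructor 3.
      by constructor 4.
  - by move=> *; apply: subalg_D.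
  - exact: subalg_Z.
  - by move=> *; apply: subalg_M.
(* The co-structure formulas express Delta' and kappa' of an entry through entries of the same
   matrix. *)
have GL (L : 'I_N.+2 -> 'I_N.+2 -> hdual p) :
    matrix_rep L -> costructure_rel L -> (forall A B, G (L A B)) ->
    forall A B, splits G (L A B) /\ subalg_gen G (dual_antipode (L A B)).
  move=> HL [_ _ hS] hG A B; split.
    exists 'I_N.+2, (L A), (L^~ B); split=> [C|x y]; last exact: HL.2.
    by split; apply: subalg_in.
  rewrite hS; apply: subalg_gen_sum => C; apply: subalg_gen_sum => D.
  exact/subalg_Z/subalg_in.
have GcL := GL _ RcL cL (fun A B => Or33 _ _ (ex_intro _ A (ex_intro _ B erefl))).
have GLm := GL _ Rm cm (fun A B => Or32 _ _ (ex_intro _ A (ex_intro _ B erefl))).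
split; [split|split; [split|split; split]] => //.
- have -> : IU = subalg_gen G by apply/funext => phi; apply/propext.
  apply: hopf_subalg_gen => phi [->|[A [B ->]]|[A [B ->]]].
  + exact: splits1.
  + by case: (GLm A B).
  + by case: (GcL A B).
  + by rewrite dual_antipode1; apply: subalg_1.
  + by case: (GLm A B).
  + by case: (GcL A B).
- move=> phi; elim=> {phi} [phi|||k phi _ h|].
  + case=> [->|[[A [B ->]]|[a [b [_ _ ->]]]|->|->]]; first exact: subalg_1.
    * by apply: subalg_in; constructor 3; exists A, B.
    * by apply: subalg_in; constructor 2; exists a, b.
    * by apply: subalg_in; constructor 2; exists ord0, ord0.
    * by apply: subalg_in; constructor 2; exists ord_max, ord_max.
  + exact: subalg_1.
  + by move=> *; apply: subalg_D.
  + exact: subalg_Z.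
  + by move=> *; apply: subalg_M.
- exact: block_diag_exchange_calR.
- exact: dual_pair_exchange dm.
- exact: calR_exchange HLplus HLminus RcL hR.
- exact: block_diag_metric wp (dual_pair_metric Rp Rm dp).
- exact: dual_pair_metric Rm Rp dm.
Qed.
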